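(* Let $\mathscr W$ be a class of nonnegative measurable output weights on $I$. Suppose that $u$, $u\chi_{(a,c)}$, and $u\chi_{(d,b)}$ belong to $\mathscr W$ for every $a<c<d<b$. Suppose further that a nonnegative functional $\mathcal A(w;v_1,v_2)$ (with values in $[0,\infty]$) and constants $C_1,C_2>0$, depending only on $p_1,p_2,q$ and independent of $w\in\mathscr W$, satisfy $$C_1\mathcal A(w;v_1,v_2)\le\|\mathcal H_2\|_{L^{p_1}(v_1;I)\times L^{p_2}(v_2;I)\to L^q(w;I)}\le C_2\mathcal A(w;v_1,v_2)$$ for every $w\in\mathscr W$. Then $\mathcal H_2:L^{p_1}(v_1;I)\times L^{p_2}(v_2;I)\to L^q(u;I)$ is compact if and only if $$\mathcal A(u;v_1,v_2)<\infty,\qquad \lim_{c\downarrow a}\mathcal A(u\chi_{(a,c)};v_1,v_2)=0,\qquad \lim_{d\uparrow b}\mathcal A(u\chi_{(d,b)};v_1,v_2)=0 .$$ Moreover, if $$\mathcal A_-^*:=\limsup_{c\downarrow a}\mathcal A(u\chi_{(a,c)};v_1,v_2),\qquad \mathcal A_+^*:=\limsup_{d\uparrow b}\mathcal A(u\chi_{(d,b)};v_1,v_2),$$ then, whenever $\mathcal H_2:L^{p_1}(v_1;I)\times L^{p_2}(v_2;I)\to L^q(u;I)$ is bounded, $$C_1\max\{\mathcal A_-^*,\mathcal A_+^*\}\le\|\mathcal H_2\|_{\mathrm e}\le C_2\big((\mathcal A_-^* )^q+(\mathcal A_+^* )^q\big)^{1/q}.$$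
   Context: Let $-\infty\le a<b\le\infty$, $I=(a,b)$, $1<p_1,p_2<\infty$, $0<q<\infty$, $1/p_i+1/p_i'=1$. Let $v_1,v_2$ be measurable on $I$, positive and finite a.e., and let $u\ge0$ be measurable with $u\in L^1_{\mathrm{loc}}(I)$. Assume $V_i(x):=\int_a^x v_i(t)^{1-p_i'}\,dt<\infty$ for all $x\in I$, $i=1,2$. $X_i=L^{p_i}(v_i;I)$ has norm $\|f\|_{X_i}=(\int_I|f|^{p_i}v_i\,dx)^{1/p_i}$; for a nonnegative measurable $w$, $L^q(w;I)$ has (quasi-)norm $(\int_I|h|^qw\,dx)^{1/q}$ (real or complex functions, identified when equal a.e. for the relevant measure). $Y=L^q(u;I)$ carries the topology of the metric $\|h-k\|_Y^{\min\{1,q\}}$. Define $Hf(x)=\int_a^xf(t)\,dt$ and $\mathcal H_2(f,g)(x)=Hf(x)\,Hg(x)$. The operator (quasi-)norm $\|\mathcal H_2\|_{X_1\times X_2\to L^q(w;I)}\in[0,\infty]$ is $\sup_{\|f\|_{X_1}\le1,\|g\|_{X_2}\le1}\|\mathcal H_2(f,g)\|_{L^q(w;I)}$, equal to $\infty$ when the operator is unbounded. A bilinear map $T:X_1\times X_2\to Y$ is compact if the image of the product of the closed unit balls has compact closure in $Y$. For bounded $T$, $\|T\|_{\mathrm e}=\inf\|T-K\|_{X_1\times X_2\to Y}$ over compact bilinear maps $K:X_1\times X_2\to Y$. If $a=-\infty$, $c\downarrow a$ means $c\to-\infty$; if $b=\infty$, $d\uparrow b$ means $d\to+\infty$. *)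

(* Defs.v *)
From HB Require Import structures.
From mathcomp Require Import all_boot all_order all_algebra.
From mathcomp Require Import sesquilinear ring_quotient.
From mathcomp Require Import all_classical all_reals all_analysis measurable_realfun.
From mathcomp.real_closed Require Import complex.

Set Implicit Arguments.
Unset Strict Implicit.
Unset Printing Implicit Defensive.

Import Order.TTheory GRing.Theory Num.Theory.
Import numFieldNormedType.Exports.

Local Open Scope classical_set_scope.
Local Open Scope ring_scope.

(* Functions take real or complex values; everything is parametrized by the
   choice of scalar field. *)
Variant scalars := RealScalars | ComplexScalars.

Section Scalars.
Variable R : realType.

Definition scalar (s : scalars) : numFieldType :=
  match s with RealScalars => R | ComplexScalars => R[i] end.

Definition re_part (s : scalars) : scalar s -> R :=
  match s return scalar s -> R with
  | RealScalars => fun z => z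
  | ComplexScalars => fun z => complex.Re z
  end.

Definition im_part (s : scalars) : scalar s -> R :=
  match s return scalar s -> R with
  | RealScalars => fun _ => 0
  | ComplexScalars => fun z => complex.Im z
  end.

Definition mk_scalar (s : scalars) : R -> R -> scalar s :=
  match s return R -> R -> scalar s with
  | RealScalars => fun x _ => x
  | ComplexScalars => fun x y => Complex x y
  end.

(* [`|z|] lives in the scalar field itself. *)
Definition modulus (s : scalars) (z : scalar s) : R := re_part `|z|.

Lemma re_partD s (y z : scalar s) : re_part (y + z) = re_part y + re_part z.
Proof. by case: s y z => // [[? ?] [? ?]]. Qed.

Lemma im_partD s (y z : scalar s) : im_part (y + z) = im_part y + im_part z.
Proof. by case: s y z => [? ?|[? ?] [? ?]] //=; rewrite addr0. Qed.

Lemma re_partM s (y z : scalar s) :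
  re_part (y * z) = re_part y * re_part z - im_part y * im_part z.
Proof. by case: s y z => [? ?|[? ?] [? ?]] //=; rewrite mul0r subr0. Qed.

Lemma im_partM s (y z : scalar s) :
  im_part (y * z) = re_part y * im_part z + im_part y * re_part z.
Proof. by case: s y z => [? ?|[? ?] [? ?]] //=; rewrite mul0r mulr0 addr0. Qed.

Lemma modulusE s (z : scalar s) :
  modulus z = Num.sqrt (re_part z ^+ 2 + im_part z ^+ 2).
Proof.
case: s z => [z|[x y]] //=; rewrite /modulus/=.
by rewrite expr0n addr0 sqrtr_sqr.
Qed.

Lemma modulus_ge0 s (z : scalar s) : 0 <= modulus z.
Proof. by rewrite modulusE sqrtr_ge0. Qed.

Lemma modulus0 s : modulus (0 : scalar s) = 0.
Proof.
rewrite modulusE; case: s => /=; by rewrite expr0n/= addr0 sqrtr0.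
Qed.

Lemma modulusD s (y z : scalar s) : modulus (y + z) <= modulus y + modulus z.
Proof.
case: s y z => [y z|y z]; first exact: ler_normD.
exact: le_normcD.
Qed.

Lemma modulusM s (y z : scalar s) : modulus (y * z) = modulus y * modulus z.
Proof.
case: s y z => [y z|y z]; first exact: normrM.
exact: Normc.normcM.
Qed.

End Scalars.


Section Weights.
Variable R : realType.
Local Notation mu := (@lebesgue_measure R).

(* The open interval with extended endpoints, as a set of reals. *)
Definition oitv (a b : \bar R) : set R := [set x | (a < x%:E < b)%E].

Lemma measurable_oitv a b : measurable (oitv a b).
Proof.
have -> : oitv a b = EFin @^-1` [set` Interval (BRight a) (BLeft b)].
  by apply/seteqP; split=> x; rewrite /oitv/= in_itv/=.
rewrite -[X in measurable X]setTI.
have /measurable_EFinP : measurable_fun setT (@id R) by exact: measurable_id.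
by apply => //; exact: emeasurable_itv.
Qed.

(* Weights may take the value +oo. *)
Definition is_weight (a b : \bar R) (w : R -> \bar R) :=
  measurable_fun (oitv a b) w /\
  {ae mu, forall x, oitv a b x -> (0 <= w x)%E}.

Record weight (a b : \bar R) := Weight {
  weight_fun :> R -> \bar R;
  weightP : is_weight a b weight_fun
}.

Definition restrict_weight (w : R -> \bar R) (D : set R) : R -> \bar R :=
  fun x => (w x * (\1_D x)%:E)%E.

Definition locally_integrable_weight (a b : \bar R) (w : R -> \bar R) :=
  forall K : set R, K `<=` oitv a b -> compact K -> mu.-integrable K w.

(* c decreases to a, resp. d increases to b; the values at the remaining
   infinite endpoint are irrelevant, as a < b. *)
Definition decr_to (a : \bar R) : set_system R :=
  match a with r%:E => r^'+ | -oo%E => -oo | +oo%E => +oo end.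

Definition incr_to (b : \bar R) : set_system R :=
  match b with r%:E => r^'- | +oo%E => +oo | -oo%E => -oo end.

End Weights.

Section Lebesgue_spaces.
Variables (R : realType) (s : scalars).
Local Notation mu := (@lebesgue_measure R).
Local Notation K := (scalar R s).

Definition scalar_measurable_fun (D : set R) (f : R -> K) :=
  measurable_fun D (fun x => re_part (f x)) /\
  measurable_fun D (fun x => im_part (f x)).

Definition scalar_integral (D : set R) (f : R -> K) : K :=
  mk_scalar s (\int[mu]_(x in D) re_part (f x))
              (\int[mu]_(x in D) im_part (f x)).

Variables (a b : \bar R).
Local Notation I := (oitv a b).

Definition wnorm (p : R) (w : R -> \bar R) (f : R -> K) : \bar R :=
  poweR (\int[mu]_(x in I) ((modulus (f x) `^ p)%:E * w x))%E p^-1.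

Variables (p : {posnum R}) (w : weight a b).

Lemma measurable_modulus (f : R -> K) : scalar_measurable_fun I f ->
  measurable_fun I (fun x => modulus (f x)).
Proof.
move=> [mre mim]; under eq_fun do rewrite modulusE.
apply: (measurableT_comp (continuous_measurable_fun (@sqrt_continuous R))).
by apply: measurable_funD; exact: measurable_funX.
Qed.

Let F (f : R -> K) x := ((modulus (f x) `^ p%:num)%:E * w x)%E.

Let measurableF f : scalar_measurable_fun I f -> measurable_fun I (F f).
Proof.
move=> mf; apply: emeasurable_funM; last exact: (weightP w).1.
apply/measurable_EFinP.
by apply: (measurableT_comp (measurable_powR _)); exact: measurable_modulus.
Qed.

Lemma wnorm_integrable f : scalar_measurable_fun I f ->
  (wnorm p%:num w f < +oo)%E <-> mu.-integrable I (F f).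
Proof.
move=> mf; have mI := measurable_oitv a b; have mF := measurableF mf.
have -> : (wnorm p%:num w f < +oo)%E <-> (\int[mu]_(x in I) `|F f x| < +oo)%E.
  rewrite /wnorm.
  have -> : (\int[mu]_(x in I) F f x = \int[mu]_(x in I) `|F f x|)%E.
    have FE : {ae mu, forall x, I x -> F f x = `|F f x|%E}.
      apply: (@filterS _ _ (ae_filter_ringOfSetsType _) _ _ _ (weightP w).2) => x wx Ix.
      by rewrite gee0_abs// mule_ge0 ?wx// lee_fin powR_ge0.
    by apply: ae_eq_integral => //; exact: measurableT_comp.
  split; last exact: poweR_lty.
  by apply: lty_poweRy; rewrite invr_eq0.
by split=> [h|/integrableP[]//]; exact/integrableP.
Qed.

(* Functions on I are represented by functions on R, whose values outside I
   play no role. [K^o] is K as a vector space over itself. *)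
Definition Lfunctions : {pred R -> K^o} :=
  fun f => `[< scalar_measurable_fun I f /\ (wnorm p%:num w f < +oo)%E >].

Lemma Lfunctions_submod_closed : submod_closed Lfunctions.
Proof.
have mI := measurable_oitv a b.
split=> [|c f g /asboolP[mf nf] /asboolP[mg ng]]; apply/asboolP.
  split; first by split; case: (s) => /=; exact: measurable_cst.
  apply/wnorm_integrable; first by split; case: (s) => /=; exact: measurable_cst.
  apply: (@le_integrable _ _ _ mu _ mI (F 0) (cst 0%E)) => //.
  - by apply: measurableF; split; case: (s) => /=; exact: measurable_cst.
  - by move=> x _; rewrite /F modulus0 powR0// mul0e.
  - exact: integrable0.
have mfg : scalar_measurable_fun I (c *: f + g).
  case: mf mg => rf imf [rg img]; split.
    rewrite (_ : (fun x => _) = fun x => re_part c * re_part (f x)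
        - im_part c * im_part (f x) + re_part (g x)).
      apply: measurable_funD => //; apply: measurable_funB;
        exact: measurable_funM.
    by apply/funext => x; rewrite re_partD re_partM.
  rewrite (_ : (fun x => _) = fun x => re_part c * im_part (f x)
      + im_part c * re_part (f x) + im_part (g x)).
    apply: measurable_funD => //; apply: measurable_funD;
      exact: measurable_funM.
  by apply/funext => x; rewrite im_partD im_partM.
split; first exact: mfg.
apply/(wnorm_integrable mfg).
pose r := (2 `^ p%:num : R); pose k := modulus c `^ p%:num.
apply: (@le_integrable _ _ _ mu _ mI _
  (fun x => (r * k)%:E * F f x + r%:E * F g x)%E).
- exact: measurableF.
- move=> x Ix; set A := modulus (f x) `^ p%:num; set B := modulus (g x) `^ p%:num.
  have A0 : 0 <= A := powR_ge0 _ _.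
  have B0 : 0 <= B := powR_ge0 _ _.
  have r0 : 0 <= r := powR_ge0 _ _.
  have k0 : 0 <= k := powR_ge0 _ _.
  rewrite /F !muleA -!EFinM -ge0_muleDl ?lee_fin ?mulr_ge0//.
  rewrite !abseM lee_wpmul2r//= lee_fin ger0_norm ?powR_ge0//.
  rewrite ger0_norm ?addr_ge0 ?mulr_ge0// -mulrA -mulrDr.
  have pw : {in Num.nneg &, {homo (fun t : R => t `^ p%:num) : y z / y <= z}}.
    exact: ge0_ler_powR.
  have m0 (z : K) : modulus z \in Num.nneg by rewrite nnegrE modulus_ge0.
  pose m := Num.max (modulus c * modulus (f x)) (modulus (g x)).
  have m_ge0 : 0 <= m by rewrite le_max modulus_ge0 orbT.
  apply: (@le_trans _ _ ((2 * m) `^ p%:num)).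
    apply: pw => //; first by rewrite nnegrE mulr_ge0.
    apply: (le_trans (modulusD _ _)); rewrite modulusM mulr_natl mulr2n.
    by apply: lerD; rewrite /m le_max lexx ?orbT.
  rewrite powRM// ler_wpM2l// /m.
  rewrite maxEle; case: ifP => _; first by rewrite -/B lerDr mulr_ge0.
  by rewrite powRM ?modulus_ge0// lerDl.
- apply: integrableD; [exact: mI| |].
    by apply: integrableZl; [exact: mI|exact/(wnorm_integrable mf)].
  by apply: integrableZl; [exact: mI|exact/(wnorm_integrable mg)].
Qed.

HB.instance Definition _ :=
  GRing.isSubmodClosed.Build K (R -> K^o) Lfunctions Lfunctions_submod_closed.

Definition Lfun := {f : R -> K^o | f \in Lfunctions}.

HB.instance Definition _ := SubType.on Lfun.
HB.instance Definition _ := Choice.on Lfun.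
HB.instance Definition _ := [SubChoice_isSubLmodule of Lfun by <:].

(* A set is null for the measure w dx iff w = 0 almost everywhere on it. *)
Definition ae_eq_weight (f g : R -> K) :=
  {ae mu, forall x, I x -> w x != 0%E -> f x = g x}.

Definition Lnull : {pred Lfun} := fun f => `[< ae_eq_weight (val f) (cst 0) >].

Lemma Lnull_submod_closed : submod_closed Lnull.
Proof.
split=> [|c f g /asboolP f0 /asboolP g0]; apply/asboolP.
  exact: nearW.
apply: (@filterS2 _ _ (ae_filter_ringOfSetsType _) _ _ _ _ f0 g0) => x {}f0 {}g0 Ix wx /=.
by rewrite !fctE f0// g0//= scaler0 addr0.
Qed.

HB.instance Definition _ :=
  GRing.isSubmodClosed.Build K Lfun Lnull Lnull_submod_closed.

Definition Lp := {ideal_quot Lnull}.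

HB.instance Definition _ := Choice.on Lp.
HB.instance Definition _ := GRing.Zmodule.on Lp.

Local Open Scope quotient_scope.

Definition Lp_scale (c : K) (f : Lp) : Lp := \pi_Lp (c *: (repr f : Lfun)).

Lemma Lp_scaleE c (f : Lfun) : Lp_scale c (\pi_Lp f) = \pi_Lp (c *: f).
Proof.
apply/eqP; rewrite -Quotient.idealrBE -scalerBr rpredZ//.
by rewrite Quotient.idealrBE reprK.
Qed.

Fact Lp_scalerA c d f : Lp_scale c (Lp_scale d f) = Lp_scale (c * d) f.
Proof. by rewrite -[f]reprK [Lp_scale d _]Lp_scaleE !Lp_scaleE scalerA. Qed.

Fact Lp_scale1r : left_id 1 Lp_scale.
Proof. by move=> f; rewrite -[f]reprK Lp_scaleE scale1r. Qed.

Fact Lp_scalerDr : right_distributive Lp_scale +%R.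
Proof.
move=> c f g; rewrite -[f]reprK -[g]reprK !Lp_scaleE.
by rewrite -!(raddfD (\pi_Lp)) Lp_scaleE scalerDr.
Qed.

Fact Lp_scalerDl f : {morph Lp_scale^~ f : c d / c + d}.
Proof.
move=> c d; rewrite -[f]reprK !Lp_scaleE.
by rewrite -!(raddfD (\pi_Lp)) scalerDl.
Qed.

HB.instance Definition _ := GRing.Zmodule_isLmodule.Build K Lp
  Lp_scalerA Lp_scale1r Lp_scalerDr Lp_scalerDl.

(* A representative of the class. *)
Definition Lp_fun (f : Lp) : R -> K := val (repr f : Lfun).

Definition Lp_norm (f : Lp) : \bar R := wnorm p%:num w (Lp_fun f).

Definition Lp_unit_ball : set Lp := [set f | (Lp_norm f <= 1)%E].

(* The topology of the metric ||f - g||^(min 1 p): a set is open iff it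
   contains a ball around each of its points. *)
Definition Lp_open (U : set Lp) := forall f, U f -> exists2 e : R, 0 < e &
  forall g, (poweR (Lp_norm (f - g)%R) (Num.min 1 p%:num)%R < e%:E)%E -> U g.

Lemma Lp_openT : Lp_open setT.
Proof. by move=> f _; exists 1. Qed.

Lemma Lp_openI : setI_closed Lp_open.
Proof.
move=> U V oU oV f [/oU[e e0 eU] /oV[e' e'0 eV]].
exists (Num.min e e'); first by rewrite lt_min e0.
by move=> g; rewrite EFin_min lt_min => /andP[/eU ? /eV].
Qed.

Lemma Lp_open_bigU (J : Type) (U : J -> set Lp) :
  (forall j, Lp_open (U j)) -> Lp_open (\bigcup_j U j).
Proof.
move=> oU f [j _ /(oU j)[e e0 eU]].
by exists e => // g /eU; exists j.
Qed.

HB.instance Definition _ := isOpenTopological.Build Lp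
  Lp_openT Lp_openI Lp_open_bigU.

End Lebesgue_spaces.

Arguments Lp_unit_ball {R s a b} p w _.

Section Operators.
Variables (R : realType) (s : scalars) (a b : \bar R).
Local Notation K := (scalar R s).

(* For f in X1 or X2 and x in I the integral converges absolutely, by Hoelder's
   inequality and the finiteness of V1(x) and V2(x). *)
Definition Hardy (f : R -> K) (x : R) : K := scalar_integral (oitv a x%:E) f.

Variables (p1 p2 q : {posnum R}) (v1 v2 u : weight a b).
Local Notation X1 := (Lp s p1 v1).
Local Notation X2 := (Lp s p2 v2).
Local Notation Y := (Lp s q u).

Definition Hardy2 (f : X1) (g : X2) : R -> K :=
  fun x => Hardy (Lp_fun f) x * Hardy (Lp_fun g) x.

(* The quasi-norm of an operator with values in L^q(w; I). The operator maps
   to functions and w is any weight, so that the value can be +oo. *)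
Definition opnorm (w : R -> \bar R) (T : X1 -> X2 -> R -> K) : \bar R :=
  ereal_sup [set wnorm a b q%:num w (T f g) |
             f in Lp_unit_ball p1 v1 & g in Lp_unit_ball p2 v2].

Definition compact_map (T : X1 -> X2 -> Y) :=
  compact (closure [set T f g |
             f in Lp_unit_ball p1 v1 & g in Lp_unit_ball p2 v2]).

(* T takes values in Y and, as a map into Y, is bilinear and compact. *)
Definition compact_operator (T : X1 -> X2 -> R -> K) :=
  exists T' : {bilinear X1 -> X2 -> Y},
    (forall f g, ae_eq_weight u (Lp_fun (T' f g)) (T f g)) /\ compact_map T'.

Definition essential_norm (T : X1 -> X2 -> R -> K) : \bar R :=
  ereal_inf [set opnorm u (fun f g x => T f g x - Lp_fun (S f g) x) |
             S in [set S : {bilinear X1 -> X2 -> Y} | compact_map S]].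

End Operators.

(* Main.v *)
(* The image of the product of the unit balls under H_2 cut off to D is compact
   in L^q(u) as soon as it is bounded and its mass outside [c, d] is uniformly
   small for suitable c and d: by Young's inequality the functions Hf, with f in
   the unit ball, are pointwise bounded and equicontinuous on I, so the closure
   Phi of the set of pairs (Hf, Hg) in the topology of pointwise convergence is
   compact (Tychonoff). On Phi pointwise convergence is uniform on [c, d], and by
   Fatou's lemma the tail bounds pass from the pairs (Hf, Hg) to Phi; hence the
   product, cut off to D, is a continuous map from Phi to L^q(u), and the image of
   the compact set Phi is compact. No completeness of L^q(u) is needed.

   D = I gives the sufficiency of the three conditions, and D = [c, d] the upper
   bound, the cut-off operator being the compact approximation. Conversely, on
   the (relatively compact) image of a compact bilinear map, the quasi-norms of
   the restrictions to (a, c) and (d, b) tend to 0 uniformly; subtracting, the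
   norm of H_2 into L^q(u 1_(a,c)) is asymptotically at most ||H_2 - K||. *)

From HB Require Import structures.
From Pilot Require Import Defs.
From mathcomp Require Import all_boot all_order all_algebra.
From mathcomp Require Import sesquilinear ring_quotient.
From mathcomp Require Import all_classical all_reals all_analysis.
From mathcomp Require Import measurable_realfun lra ring.

Set Implicit Arguments.
Unset Strict Implicit.
Unset Printing Implicit Defensive.
Import Order.TTheory GRing.Theory Num.Theory.
Import numFieldNormedType.Exports.
Local Open Scope classical_set_scope.
Local Open Scope ring_scope.

(** * Scalars and weighted integrals *)

(** For [q < 1] the space L^q(u) is not normed, so estimates are made on the integral of |h|^q u
    ([pint]) and raised to [gauge_exp] only when the metric is needed. There the triangle inequality
    has constant exactly 1 for every [q]; a factor such as 2^q in the subtraction step would spoil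
    the constant [C1] of the lower bound. In the upper bound no triangle inequality occurs: the
    error of the cut-off operator lives on two disjoint sets, the q-th powers add exactly, and this
    is the origin of the sum of q-th powers under the root.

    Young's inequality is used with a free parameter l, bounding |f| by l |f|^p v + l^(1-p')
    v^(1-p'). The choice l = 1 gives the pointwise bounds; a small l makes the first term small for
    all f in a ball at once, and absolute continuity of the integral of v^(1-p') then handles the
    second.

    The topology of pointwise convergence on an uncountable index set is not described by sequences.
    Continuity on the closure is therefore argued with filters, and Fatou's lemma needs a sequence
    built by hand from uniform approximation on an exhaustion of I. *)

Section ScalarParts.
Variables (R : realType) (s : scalars).
Local Notation K := (Defs.scalar R s).

Lemma scalar_eq (y z : K) : re_part y = re_part z -> im_part y = im_part z -> y = z.
Proof. by case: s y z => [? ?|[? ?] [? ?]] //= -> ->. Qed.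

Lemma re_partN (z : K) : re_part (- z) = - re_part z.
Proof. by case: s z => // -[? ?]. Qed.

Lemma im_partN (z : K) : im_part (- z) = - im_part z.
Proof. by case: s z => [?|[? ?]] //=; rewrite oppr0. Qed.

Lemma modulusN (z : K) : modulus (- z) = modulus z.
Proof. by rewrite !modulusE re_partN im_partN !sqrrN. Qed.

Lemma re_mk_scalar x y : re_part (mk_scalar s x y) = x :> R.
Proof. by case: s. Qed.

Lemma mk_scalarK (z : K) : mk_scalar s (re_part z) (im_part z) = z.
Proof. by case: s z => // -[]. Qed.

Lemma modulus_ge_re (z : K) : `|re_part z| <= modulus z.
Proof.
by rewrite modulusE -sqrtr_sqr ler_wsqrtr// lerDl sqr_ge0.
Qed.

Lemma modulus_ge_im (z : K) : `|im_part z| <= modulus z.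
Proof.
by rewrite modulusE -sqrtr_sqr ler_wsqrtr// lerDr sqr_ge0.
Qed.

Lemma modulus_le_parts (z : K) : modulus z <= `|re_part z| + `|im_part z|.
Proof.
rewrite modulusE -(ler_pXn2r (ltn0Sn 1)) ?nnegrE ?sqrtr_ge0 ?addr_ge0//.
rewrite sqr_sqrtr ?addr_ge0 ?sqr_ge0// sqrrD !real_normK ?num_real//.
by have := mulr_ge0 (normr_ge0 (re_part z)) (normr_ge0 (im_part z)); rewrite mulr2n; lra.
Qed.

Lemma modulus_eq0 (z : K) : modulus z = 0 -> z = 0.
Proof.
move=> z0; have := modulus_ge_re z; have := modulus_ge_im z.
rewrite z0 !normr_le0 => /eqP i0 /eqP r0.
by apply: scalar_eq; rewrite ?r0 ?i0; case: (s).
Qed.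

Lemma modulus_real (x : R) : modulus (mk_scalar s x 0) = `|x|.
Proof.
rewrite modulusE re_mk_scalar; case: s => /=; by rewrite expr0n/= addr0 sqrtr_sqr.
Qed.

Lemma scalar_measurableS (D E : set R) (f : R -> K) : measurable D ->
  E `<=` D -> scalar_measurable_fun D f -> scalar_measurable_fun E f.
Proof. by move=> mD ED [fr fi]; split; [move: fr|move: fi]; exact: measurable_funS. Qed.

Lemma scalar_measurableD (D : set R) (f g : R -> K) :
  scalar_measurable_fun D f -> scalar_measurable_fun D g ->
  scalar_measurable_fun D (fun x => f x + g x).
Proof.
move=> [fr fi] [gr gi]; split.
  by under eq_fun do rewrite re_partD; exact: measurable_funD.
by under eq_fun do rewrite im_partD; exact: measurable_funD.
Qed.

Lemma scalar_measurableN (D : set R) (f : R -> K) :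
  scalar_measurable_fun D f -> scalar_measurable_fun D (fun x => - f x).
Proof.
move=> [fr fi]; split.
  by under eq_fun do rewrite re_partN; exact: measurableT_comp.
by under eq_fun do rewrite im_partN; exact: measurableT_comp.
Qed.

Lemma scalar_measurableB (D : set R) (f g : R -> K) :
  scalar_measurable_fun D f -> scalar_measurable_fun D g ->
  scalar_measurable_fun D (fun x => f x - g x).
Proof. by move=> mf mg; apply: scalar_measurableD => //; exact: scalar_measurableN. Qed.

Lemma scalar_measurableM (D : set R) (f g : R -> K) :
  scalar_measurable_fun D f -> scalar_measurable_fun D g ->
  scalar_measurable_fun D (fun x => f x * g x).
Proof.
move=> [fr fi] [gr gi]; split.
  under eq_fun do rewrite re_partM.
  by apply: measurable_funB; exact: measurable_funM.
under eq_fun do rewrite im_partM.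
by apply: measurable_funD; exact: measurable_funM.
Qed.

Lemma scalar_measurable_cst (D : set R) (c : K) : scalar_measurable_fun D (fun=> c).
Proof. by split; exact: measurable_cst. Qed.

Lemma scalar_measurable_modulus (D : set R) (f : R -> K) :
  scalar_measurable_fun D f -> measurable_fun D (fun x => modulus (f x)).
Proof.
move=> [fr fi]; under eq_fun do rewrite modulusE.
apply: (measurableT_comp (continuous_measurable_fun (@sqrt_continuous R))).
by apply: measurable_funD; exact: measurable_funX.
Qed.

End ScalarParts.

(* Locked because failing conversions between integrals are very slow. *)
HB.lock Definition pint (R : realType) (s : scalars) (p : R) (w : R -> \bar R)
    (D : set R) (h : R -> Defs.scalar R s) : \bar R :=
  (\int[@lebesgue_measure R]_(x in D) ((modulus (h x) `^ p)%:E * `|w x|))%E.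

(** * Weighted integrals of |h|^p and their triangle inequalities *)

Section Pint.
Variables (R : realType) (s : scalars) (p : R) (p0 : 0 < p) (w : R -> \bar R).
Local Notation mu := (@lebesgue_measure R).
Local Notation K := (Defs.scalar R s).
Implicit Types (D E : set R) (h k : R -> K).
Local Open Scope ereal_scope.

Local Notation pint := (@pint R s p w).

Lemma pintE D h : pint D h = \int[mu]_(x in D) ((modulus (h x) `^ p)%:E * `|w x|).
Proof. by rewrite unlock. Qed.

Lemma pint_ge0 D h : 0 <= pint D h.
Proof. by rewrite pintE; apply: integral_ge0 => x _; rewrite mule_ge0// lee_fin powR_ge0. Qed.

Lemma pintegrand_ge0 h x : 0 <= (modulus (h x) `^ p)%:E * `|w x|.
Proof. by rewrite mule_ge0// lee_fin powR_ge0. Qed.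

Lemma measurable_pintegrand D h : measurable_fun D w -> scalar_measurable_fun D h ->
  measurable_fun D (fun x => (modulus (h x) `^ p)%:E * `|w x|).
Proof.
move=> mw mh; apply: emeasurable_funM; last exact: measurableT_comp.
apply/measurable_EFinP; apply: (measurableT_comp (measurable_powR _)).
exact: scalar_measurable_modulus.
Qed.

Lemma le_pint D h k : measurable D -> measurable_fun D w ->
  scalar_measurable_fun D h -> scalar_measurable_fun D k ->
  (forall x, D x -> modulus (h x) <= modulus (k x))%R -> pint D h <= pint D k.
Proof.
move=> mD mw mh mk hk; rewrite !pintE; apply: ge0_le_integral => //.
- by move=> x _; exact: pintegrand_ge0.
- exact: measurable_pintegrand.
- exact: measurable_pintegrand.
move=> x Dx; rewrite lee_wpmul2r// lee_fin ge0_ler_powR ?nnegrE ?modulus_ge0 ?(ltW p0)//.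
exact: hk.
Qed.

Lemma subset_pint D E h : measurable D -> measurable E -> measurable_fun E w ->
  scalar_measurable_fun E h -> D `<=` E -> pint D h <= pint E h.
Proof.
move=> mD mE mw mh DE; rewrite !pintE; apply: ge0_subset_integral => //.
  exact: measurable_pintegrand.
by move=> x _; exact: pintegrand_ge0.
Qed.

Lemma pint_setU D E h : measurable D -> measurable E -> measurable_fun (D `|` E) w ->
  scalar_measurable_fun (D `|` E) h -> D `&` E = set0 ->
  pint (D `|` E) h = pint D h + pint E h.
Proof.
move=> mD mE mw mh DE; rewrite !pintE; apply: ge0_integral_setU => //.
- exact: measurable_pintegrand.
- by move=> x _; exact: pintegrand_ge0.
- by apply/disj_setPS; rewrite DE.
Qed.

Lemma eq_pint D h k : (forall x, D x -> h x = k x) -> pint D h = pint D k.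
Proof. by move=> hk; rewrite !pintE; apply: eq_integral => x; rewrite inE => Dx; rewrite hk. Qed.

Lemma ae_eq_pint D h k : measurable D -> measurable_fun D w ->
  scalar_measurable_fun D h -> scalar_measurable_fun D k ->
  {ae mu, forall x, D x -> w x != 0 -> h x = k x} -> pint D h = pint D k.
Proof.
move=> mD mw mh mk hk; rewrite !pintE; apply: ae_eq_integral => //; try exact: measurable_pintegrand.
apply: (@filterS _ _ (ae_filter_ringOfSetsType _) _ _ _ hk) => x {}hk Dx.
have [->|w0] := eqVneq (w x) 0; first by rewrite abse0 !mule0.
by rewrite hk.
Qed.

Lemma pint_eq0 D h : measurable D -> measurable_fun D w ->
  scalar_measurable_fun D h -> pint D h = 0 ->
  {ae mu, forall x, D x -> w x != 0 -> h x = 0%R}.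
Proof.
move=> mD mw mh h0.
have : ae_eq mu D (fun x => (modulus (h x) `^ p)%:E * `|w x|) (cst 0).
  apply/ae_eq_integral_abs => //; first exact: measurable_pintegrand.
  rewrite -[RHS]h0 pintE; apply: eq_integral => x _.
  by rewrite gee0_abs// pintegrand_ge0.
move=> h0ae.
apply: (@filterS _ _ (ae_filter_ringOfSetsType _) _ _ _ h0ae) => x {}h0 Dx w0.
move/eqP: (h0 Dx); rewrite /= mule_eq0 abse_eq0 (negbTE w0) orbF eqe.
by rewrite powR_eq0 (gt_eqF p0) andbT => /eqP /modulus_eq0.
Qed.

Lemma pintZ D (c : K) h : measurable D -> measurable_fun D w ->
  scalar_measurable_fun D h ->
  pint D (fun x => c * h x)%R = (modulus c `^ p)%:E * pint D h.
Proof.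
move=> mD mw mh; rewrite !pintE -ge0_integralZl//; last 3 first.
- exact: measurable_pintegrand.
- by move=> x _; exact: pintegrand_ge0.
- by rewrite lee_fin powR_ge0.
by apply: eq_integral => x _; rewrite modulusM powRM ?modulus_ge0// EFinM muleA.
Qed.

Lemma powR_div (x y : R) : (0 <= x -> 0 < y -> (x / y) `^ p = x `^ p / y `^ p)%R.
Proof.
move=> x0 y0; rewrite powRM ?invr_ge0 ?(ltW y0)//.
by rewrite -(powR_inv1 (ltW y0)) -powRrM mulN1r powRN.
Qed.

Lemma powRD_le (x y : R) : (0 <= x -> 0 <= y ->
  (x + y) `^ p <= 2 `^ p * (x `^ p + y `^ p))%R.
Proof.
move=> x0 y0; apply: (@le_trans _ _ ((2 * Num.max x y) `^ p)%R).
  rewrite ge0_ler_powR ?nnegrE ?(ltW p0) ?addr_ge0//.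
    by rewrite mulr_ge0// le_max x0.
  by rewrite mulr_natl mulr2n lerD// le_max lexx ?orbT.
rewrite powRM ?le_max ?x0// ler_wpM2l ?powR_ge0// maxEle.
by case: ifP => _; rewrite ?lerDl ?lerDr powR_ge0.
Qed.

(** Common source of the triangle inequalities below: each comes from a pointwise inequality with
    its own coefficients [c] and [d]. *)
Lemma pint_le_comb D h k l (c d : R) : measurable D -> measurable_fun D w ->
  scalar_measurable_fun D h -> scalar_measurable_fun D k ->
  scalar_measurable_fun D l -> (0 <= c)%R -> (0 <= d)%R ->
  (forall x, D x ->
    modulus (l x) `^ p <= c * modulus (h x) `^ p + d * modulus (k x) `^ p)%R ->
  pint D l <= c%:E * pint D h + d%:E * pint D k.
Proof.
move=> mD mw mh mk ml c0 d0 lhk.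
have mc (e : R) (f : R -> K) : scalar_measurable_fun D f ->
    measurable_fun D (fun x => e%:E * ((modulus (f x) `^ p)%:E * `|w x|)).
  by move=> mf; apply: emeasurable_funM => //; exact: measurable_pintegrand.
have c_ge0 (e : R) (f : R -> K) x : (0 <= e)%R -> 0 <= e%:E * ((modulus (f x) `^ p)%:E * `|w x|).
  by move=> e0; rewrite mule_ge0 ?lee_fin// pintegrand_ge0.
rewrite !pintE -!ge0_integralZl//; [|exact: measurable_pintegrand|
  by move=> x _; exact: pintegrand_ge0|exact: measurable_pintegrand|
  by move=> x _; exact: pintegrand_ge0].
rewrite -ge0_integralD//; [|by move=> x _; exact: c_ge0|exact: mc
  |by move=> x _; exact: c_ge0|exact: mc].
apply: ge0_le_integral => //.
- by move=> x _; exact: pintegrand_ge0.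
- exact: measurable_pintegrand.
- by apply: emeasurable_funD; exact: mc.
move=> x Dx; rewrite !muleA -!EFinM -ge0_muleDl ?lee_fin ?mulr_ge0 ?powR_ge0//.
by rewrite lee_wpmul2r// -EFinD lee_fin lhk.
Qed.

(** Holds for every exponent at the price of the factor 2^p; it serves where that factor can be
    absorbed into the choice of a small bound. *)
Lemma pintD_le D h k l : measurable D -> measurable_fun D w ->
  scalar_measurable_fun D h -> scalar_measurable_fun D k ->
  scalar_measurable_fun D l -> (forall x, D x -> l x = h x + k x)%R ->
  pint D l <= (2 `^ p)%:E * (pint D h + pint D k).
Proof.
move=> mD mw mh mk ml lE; rewrite ge0_muleDr ?pint_ge0//.
apply: pint_le_comb => //; rewrite ?powR_ge0//.
move=> x Dx; rewrite lE// -mulrDr; apply: le_trans (powRD_le _ _); rewrite ?modulus_ge0//.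
by rewrite ge0_ler_powR ?nnegrE ?modulus_ge0 ?(ltW p0) ?addr_ge0 ?modulusD ?modulus_ge0.
Qed.

(** A ratio t in [0, 1] satisfies t <= t^p when p <= 1. Applied to x / (x + y) and y / (x + y),
    whose sum is 1, this gives the claim after division by (x + y)^p. *)
Lemma powR_concaveD (x y : R) : (p <= 1 -> 0 <= x -> 0 <= y ->
  (x + y) `^ p <= x `^ p + y `^ p)%R.
Proof.
move=> p1; rewrite le_eqVlt => /predU1P[<- _|x0].
  by rewrite add0r lerDr powR_ge0.
move=> y0; have xy0 : (0 < x + y)%R by rewrite ltr_wpDr.
have sub (z : R) : (0 <= z <= x + y -> z / (x + y) <= z `^ p / (x + y) `^ p)%R.
  move=> /andP[]; rewrite le_eqVlt => /predU1P[<- _|z0 zxy].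
    by rewrite mul0r divr_ge0// powR_ge0.
  rewrite -powR_div ?(ltW z0)//.
  by rewrite ger1_powR// divr_gt0//= ler_pdivrMr// mul1r.
rewrite -(ler_pM2r (_ : 0 < ((x + y) `^ p)^-1)%R) ?invr_gt0 ?powR_gt0//.
rewrite divff ?gt_eqF ?powR_gt0// mulrDl.
apply: le_trans (lerD (sub x _) (sub y _)); last 2 first.
- by rewrite (ltW x0) lerDl.
- by rewrite y0 lerDr ltW.
by rewrite -mulrDl divff// gt_eqF.
Qed.

(** Minkowski's inequality straight from convexity of t^p: (m + n) / (c + d) is the convex
    combination of m / c and n / d with weights c / (c + d) and d / (c + d). The coefficient [e t]
    is the resulting factor of the integral bounded by t^p. *)
Lemma pint_minkowski D h k l (c d : R) : measurable D -> measurable_fun D w ->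
  scalar_measurable_fun D h -> scalar_measurable_fun D k ->
  scalar_measurable_fun D l -> (forall x, D x -> l x = h x + k x)%R ->
  (1 <= p)%R -> (0 < c)%R -> (0 < d)%R ->
  pint D h <= (c `^ p)%:E -> pint D k <= (d `^ p)%:E ->
  pint D l <= ((c + d) `^ p)%:E.
Proof.
move=> mD mw mh mk ml lE p1 c0 d0 hc kd.
have cd0 : (0 < c + d)%R by rewrite addr_gt0.
pose e (t : R) := ((c + d) `^ p * (t / (c + d)) * (t `^ p)^-1)%R.
have e0 t : (0 < t -> 0 <= e t)%R.
  by move=> t0; rewrite !mulr_ge0 ?invr_ge0 ?powR_ge0 ?(ltW t0) ?(ltW cd0).
apply: (@le_trans _ _ ((e c)%:E * pint D h + (e d)%:E * pint D k)).
  apply: pint_le_comb => //; [exact: e0|exact: e0|].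
  move=> x Dx; rewrite lE//; set m := modulus (h x); set n := modulus (k x).
  have m0 : (0 <= m)%R := modulus_ge0 _.
  have n0 : (0 <= n)%R := modulus_ge0 _.
  apply: (@le_trans _ _ ((m + n) `^ p)%R).
    by rewrite ge0_ler_powR ?nnegrE ?(ltW p0) ?modulus_ge0 ?addr_ge0 ?modulusD.
  have t01 : (0 <= c / (c + d) <= 1)%R.
    by rewrite divr_ge0 ?(ltW c0) ?(ltW cd0)//= ler_pdivrMr// mul1r lerDl ltW.
  have /andP[t_ge0 t_le1] := t01.
  have := @convex_powR R p p1 (Itv01 t_ge0 t_le1) (m / c)%R (n / d)%R.
  rewrite !inE/= !in_itv/= !divr_ge0 ?(ltW c0) ?(ltW d0)// => /(_ isT isT).
  move=> cvx; have {cvx} : ((c / (c + d) * (m / c) + (1 - c / (c + d)) * (n / d)) `^ p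
      <= c / (c + d) * (m / c) `^ p + (1 - c / (c + d)) * (n / d) `^ p)%R by exact: cvx.
  have -> : (1 - c / (c + d) = d / (c + d))%R by field; rewrite gt_eqF.
  have -> : (c / (c + d) * (m / c) + d / (c + d) * (n / d) = (m + n) / (c + d))%R.
    by field; rewrite !gt_eqF.
  rewrite !powR_div ?addr_ge0// ler_pdivrMr ?powR_gt0// => /le_trans; apply.
  by rewrite le_eqVlt; apply/orP; left; apply/eqP; rewrite /e; ring.
apply: (@le_trans _ _ ((e c)%:E * (c `^ p)%:E + (e d)%:E * (d `^ p)%:E)).
  by apply: leeD; rewrite lee_wpmul2l// lee_fin e0.
rewrite -!EFinM -EFinD lee_fin /e le_eqVlt; apply/orP; left; apply/eqP.
by field; rewrite !gt_eqF ?powR_gt0.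
Qed.

(** The power that turns the integral of |h|^p w into the metric ||h||^(min 1 p): it is 1 for p <= 1
    and 1/p otherwise. *)
Definition gauge_exp := (p^-1 * Num.min 1 p)%R.

Lemma gauge_exp_gt0 : (0 < gauge_exp)%R.
Proof. by rewrite mulr_gt0 ?invr_gt0// lt_min ltr01. Qed.

Lemma gaugeE (t : \bar R) :
  poweR (poweR t p^-1) (Num.min 1 p)%R = poweR t gauge_exp.
Proof. by rewrite poweRrM. Qed.

Lemma le_gauge (r : R) (x y : \bar R) : (0 <= r)%R -> 0 <= x -> x <= y -> poweR x r <= poweR y r.
Proof.
move=> r0 x0 xy; apply: gt0_ler_poweR => //; rewrite in_itv/= leey andbT//.
exact: le_trans xy.
Qed.

Lemma gauge_triangle D h k l : measurable D -> measurable_fun D w ->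
  scalar_measurable_fun D h -> scalar_measurable_fun D k ->
  scalar_measurable_fun D l -> (forall x, D x -> l x = h x + k x)%R ->
  poweR (pint D l) gauge_exp <=
    poweR (pint D h) gauge_exp + poweR (pint D k) gauge_exp.
Proof.
move=> mD mw mh mk ml lE; have [p1|p1] := leP 1%R p; last first.
  have e1 (f : R -> K) : poweR (pint D f) gauge_exp = pint D f.
    rewrite (_ : gauge_exp = 1%R); first by rewrite poweRe1// pint_ge0.
    by rewrite /gauge_exp min_r ?(ltW p1)// mulVf// gt_eqF.
  rewrite !e1.
  have := @pint_le_comb D h k l 1 1 mD mw mh mk ml.
  rewrite !mul1e; apply => //.
  move=> x Dx; rewrite lE// !mul1r.
  apply: le_trans (powR_concaveD (ltW p1) (modulus_ge0 _) (modulus_ge0 _)).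
  by rewrite ge0_ler_powR ?nnegrE ?modulus_ge0 ?(ltW p0) ?addr_ge0 ?modulusD ?modulus_ge0.
have -> : gauge_exp = (p^-1)%R by rewrite /gauge_exp min_l// mulr1.
have pV0 : (0 < p^-1)%R by rewrite invr_gt0.
have [->|hfin] := eqVneq (pint D h) +oo.
  by rewrite poweRyr ?gt_eqF// addye ?leey// gt_eqF// (lt_le_trans _ (poweR_ge0 _ _)).
have [->|kfin] := eqVneq (pint D k) +oo.
  by rewrite [X in _ + X]poweRyr ?gt_eqF// addey ?leey// gt_eqF// (lt_le_trans _ (poweR_ge0 _ _)).
have fe f : pint D f != +oo -> exists2 c : R, (0 <= c)%R & pint D f = (c `^ p)%:E.
  move=> ffin; exists (fine (pint D f) `^ p^-1)%R; first exact: powR_ge0.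
  rewrite -powRrM mulVf ?gt_eqF// powRr1 ?fine_ge0 ?pint_ge0// fineK// ge0_fin_numE ?pint_ge0//.
  by rewrite lt_neqAle ffin leey.
have [c c0 cE] := fe _ hfin; have [d d0 dE] := fe _ kfin.
have pK (e : R) : (0 <= e)%R -> poweR (e `^ p)%:E p^-1 = e%:E.
  by move=> e0; rewrite poweR_EFin -powRrM mulfV ?gt_eqF// powRr1.
(* [pint_minkowski] divides by its bounds, but [c] or [d] may be 0 here; half of an arbitrary
   [e > 0] is added to each. *)
rewrite cE dE !pK//; apply/lee_addgt0Pr => e e0.
have e20 : (0 < e / 2)%R by rewrite divr_gt0.
rewrite -!EFinD.
have -> : (c + d + e = (c + e / 2) + (d + e / 2))%R by lra.
rewrite -pK ?addr_ge0 ?(ltW e20)//; apply: le_gauge; rewrite ?pint_ge0 ?(ltW pV0)//.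
apply: (pint_minkowski mD mw mh mk ml lE) => //; rewrite ?ltr_wpDl// ?cE ?dE lee_fin;
  by rewrite ge0_ler_powR ?nnegrE ?(ltW p0)// ?addr_ge0 ?(ltW e20)// lerDl ltW.
Qed.

End Pint.

(** * Exhaustion of the interval *)

Lemma powRVK (R : realType) (r x : R) : r != 0 -> 0 <= x -> (x `^ r^-1) `^ r = x.
Proof. by move=> r0 x0; rewrite -powRrM mulVf// powRr1. Qed.

Lemma powRKV (R : realType) (r x : R) : r != 0 -> 0 <= x -> (x `^ r) `^ r^-1 = x.
Proof. by move=> r0 x0; rewrite -powRrM mulfV// powRr1. Qed.

(** [powR] is exp (p ln x) only away from 0, so a limit equal to 0 is treated separately, by an
    explicit threshold. *)
Lemma cvg_powR (R : realType) (T : Type) (F : set_system T) (FF : Filter F)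
    (f : T -> R) (l p : R) : 0 < p -> (forall t, 0 <= f t) -> 0 <= l ->
  f @ F --> l -> (fun t => f t `^ p) @ F --> l `^ p.
Proof.
move=> p0 f0; rewrite le_eqVlt => /predU1P[<- fl|l0 fl].
  rewrite powR0 ?gt_eqF//; apply/cvgrPdist_lt => e e0.
  near=> t; rewrite sub0r normrN ger0_norm ?powR_ge0//.
  have : f t < e `^ p^-1.
    by near: t; move/cvgr_lt : fl; apply; rewrite powR_gt0.
  move=> fe; rewrite -[ltRHS](powRVK (lt0r_neq0 p0) (ltW e0)).
  by rewrite gt0_ltr_powR ?nnegrE ?powR_ge0.
rewrite {2}/powR gt_eqF//; apply: cvg_trans (_ : (fun t => expR (p * ln (f t))) @ F --> _).
  apply: near_eq_cvg; near=> t.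
  have : 0 < f t by near: t; move/cvgr_gt : fl; apply.
  by rewrite /powR => /gt_eqF ->.
apply: continuous_cvg; first exact: continuous_expR.
by apply: cvgM; [exact: cvg_cst|apply: continuous_cvg => //; exact: continuous_ln].
Unshelve. all: by end_near. Qed.

Lemma pint_fatou (R : realType) (s : scalars) (p : R) (w : R -> \bar R) (D : set R)
    (hn : nat -> R -> Defs.scalar R s) (h : R -> Defs.scalar R s) (M : \bar R) :
  0 < p -> measurable D -> measurable_fun D w ->
  {ae @lebesgue_measure R, forall x, D x -> w x \is a fin_num} ->
  (forall n, scalar_measurable_fun D (hn n)) -> scalar_measurable_fun D h ->
  (forall x, D x -> modulus (hn n x) @[n --> \oo] --> modulus (h x)) ->
  (forall n, (pint p w D (hn n) <= M)%E) -> (pint p w D h <= M)%E.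
Proof.
move=> p0 mD mw wfin mhn mh hnh hM.
(* The weight may be infinite on a null set, where a product with a convergent factor need not
   converge; the finite weight [w'] has the same integrals and makes the integrands converge at
   every point. *)
pose w' x := fine `|w x|%E.
have w'0 x : 0 <= w' x by exact: fine_ge0.
have mw' : measurable_fun D (fun x => (w' x)%:E).
  apply/measurable_EFinP; apply: measurableT_comp; first exact: fine_measurable.
  exact: measurableT_comp.
have pE (f : R -> Defs.scalar R s) : scalar_measurable_fun D f ->
    pint p w D f = pint p (fun x => (w' x)%:E) D f.
  move=> mf; rewrite !pintE; apply: ae_eq_integral => //; try exact: measurable_pintegrand.
  apply: (@filterS _ _ (ae_filter_ringOfSetsType _) _ _ _ wfin) => x {}wfin Dx.
  by rewrite [X in _ = (_ * X)%E]gee0_abs ?lee_fin// /w' fineK// fin_num_abs abse_id -fin_num_abs wfin.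
rewrite pE// pintE.
pose F n x := ((modulus (hn n x) `^ p)%:E * `|(w' x)%:E|)%E.
apply: (@le_trans _ _ (\int[@lebesgue_measure R]_(x in D) limn_einf (F ^~ x))%E).
  rewrite le_eqVlt; apply/orP; left; apply/eqP.
  apply: eq_integral => x; rewrite inE => Dx; apply/esym.
  apply: (cvg_limn_einf_sup _).1; rewrite /F gee0_abs ?lee_fin//.
  under eq_fun do rewrite -EFinM; rewrite -EFinM; apply/fine_cvgP; split => /=.
    exact: nearW.
  apply: cvgM; last exact: cvg_cst.
  by apply: cvg_powR => //; [move=> n; exact: modulus_ge0|exact: modulus_ge0|exact: hnh].
apply: le_trans (fatou _ _ _ _) _ => //.
- by move=> n; exact: measurable_pintegrand.
- by move=> n x _; rewrite /F mule_ge0// lee_fin powR_ge0.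
rewrite limn_einf_lim; apply: lime_le; first exact: is_cvg_einfs.
apply: nearW => n; apply: (@le_trans _ _ (pint p w D (hn n))) => //.
by rewrite pE// pintE; apply: ereal_inf_lbound => /=; exists n => /=.
Qed.

Section Intervals.
Variables (R : realType).
Local Notation mu := (@lebesgue_measure R).
Implicit Types (a b : \bar R).

Lemma open_oitv a b : open (oitv a b).
Proof.
have -> : oitv a b = [set x | (a < x%:E)%E] `&` [set x | (x%:E < b)%E].
  by apply/seteqP; split=> x; rewrite /oitv/=; [move=> /andP[]|move=> [-> ->]].
apply: openI.
  case: a => [r| |].
  - exact: open_gt.
  - have -> : [set x : R | (+oo < x%:E)%E] = set0 by apply/seteqP; split.
    exact: open0.
  - have -> : [set x : R | (-oo < x%:E)%E] = setT.
      by apply/seteqP; split => x //= _; rewrite ltNyr.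
    exact: openT.
case: b => [r| |].
- exact: open_lt.
- have -> : [set x : R | (x%:E < +oo)%E] = setT.
    by apply/seteqP; split => x //= _; rewrite ltry.
  exact: openT.
- have -> : [set x : R | (x%:E < -oo)%E] = set0 by apply/seteqP; split.
  exact: open0.
Qed.

Lemma near_decr_to a x : (a < x%:E)%E -> \forall c \near decr_to a, (a < c%:E < x%:E)%E.
Proof.
case: a => [r| |]//=.
  rewrite lte_fin => rx; apply: filterS2 (nbhs_right_gt r) (nbhs_right_lt rx) => c rc cx.
  by rewrite !lte_fin rc.
move=> _; apply: filterS (nbhs_ninfty_lt (num_real x)) => c cx.
by rewrite ltNyr lte_fin.
Qed.

Lemma near_incr_to b x : (x%:E < b)%E -> \forall d \near incr_to b, (x%:E < d%:E < b)%E.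
Proof.
case: b => [r| |]//=.
  rewrite lte_fin => xr; apply: filterS2 (nbhs_left_gt xr) (nbhs_left_lt r) => c xc cr.
  by rewrite !lte_fin xc.
move=> _; apply: filterS (nbhs_pinfty_gt (num_real x)) => c xc.
by rewrite ltry lte_fin xc.
Qed.

#[export] Instance decr_to_filter a : Filter (decr_to a).
Proof. by case: a => [r| |] /=; exact: filter_filter. Qed.

#[export] Instance incr_to_filter b : Filter (incr_to b).
Proof. by case: b => [r| |] /=; exact: filter_filter. Qed.

Lemma decr_to_proper a b : (a < b)%E -> ProperFilter (decr_to a).
Proof. by case: a => [r| |] ab /=; [exact: at_right_proper_filter|exact: proper_pinfty_nbhs|exact: proper_ninfty_nbhs]. Qed.

Lemma incr_to_proper a b : (a < b)%E -> ProperFilter (incr_to b).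
Proof. by case: b => [r| |] ab /=; [exact: at_left_proper_filter|exact: proper_pinfty_nbhs|exact: proper_ninfty_nbhs]. Qed.

Lemma left_exhaustion a x0 : (a < x0%:E)%E -> exists c : nat -> R,
  [/\ forall n, (a < (c n)%:E)%E, forall n, c n <= x0 &
    forall x, (a < x%:E)%E -> \forall n \near \oo, c n <= x].
Proof.
case: a => [r| |]//.
  rewrite lte_fin => rx; exists (fun n => r + (x0 - r) * n.+1%:R^-1); split.
  - by move=> n; rewrite lte_fin ltrDl mulr_gt0 ?subr_gt0.
  - move=> n; rewrite -lerBrDl ler_piMr ?subr_ge0 ?(ltW rx)//.
    by rewrite invf_le1// ler1n.
  - move=> x; rewrite lte_fin => rx'.
    have : (fun n => r + (x0 - r) * n.+1%:R^-1) @ \oo --> r + (x0 - r) * 0.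
      apply: cvgD; first exact: cvg_cst.
      by apply: cvgM; [exact: cvg_cst|exact: cvg_harmonic].
    by rewrite mulr0 addr0 => /cvgr_le; apply.
move=> _; exists (fun n => x0 - n%:R); split.
- by move=> n; rewrite ltNyr.
- by move=> n; rewrite gerBl.
move=> x _; near=> n; rewrite lerBlDr -lerBlDl.
by near: n; exact: nbhs_infty_ger.
Unshelve. all: by end_near. Qed.

Lemma oitv_nonempty a b : (a < b)%E -> exists x, oitv a b x.
Proof.
move=> ab; case: a b ab => [r| |] [t| |]//= ab.
- by exists ((r + t) / 2); rewrite /oitv/= !lte_fin; move: ab; rewrite lte_fin => ab; apply/andP; split; lra.
- by exists (r + 1); rewrite /oitv/= lte_fin ltry andbT; lra.
- by exists (t - 1); rewrite /oitv/= lte_fin ltNyr/=; lra.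
- by exists 0; rewrite /oitv/= ltNyr ltry.
Qed.

Lemma oitv_exhaustion a b : (a < b)%E -> exists c d : nat -> R,
  [/\ forall n, oitv a b (c n), forall n, oitv a b (d n), forall n, c n <= d n &
    forall x, oitv a b x -> \forall n \near \oo, `[c n, d n]%classic x].
Proof.
move=> /oitv_nonempty[x0 /andP[ax0 x0b]].
have [c [ac cx0 cn]] := left_exhaustion ax0.
(* The right endpoint is reduced to the left one by the reflection x -> -x. *)
have : (- b < (- x0)%:E)%E by rewrite EFinN lteN2.
move=> /left_exhaustion[d [bd dx0 dn]].
exists c, (fun n => - d n); split.
- by move=> n; rewrite /oitv/= ac/=; apply: le_lt_trans x0b; rewrite lee_fin.
- move=> n; rewrite /oitv/=; apply/andP; split.
    by apply: lt_le_trans ax0 _; rewrite lee_fin lerNr.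
  by rewrite EFinN lteNl.
- by move=> n; apply: le_trans (cx0 n) _; rewrite lerNr.
move=> x /andP[ax xb]; near=> n; rewrite /= in_itv/=; apply/andP; split.
  by near: n; exact: cn.
by rewrite lerNr; near: n; apply: dn; rewrite EFinN lteN2.
Unshelve. all: by end_near. Qed.

Lemma itv_sub_oitv a b x y : oitv a b x -> oitv a b y -> `[x, y] `<=` oitv a b.
Proof.
move=> /andP[ax _] /andP[_ yb] z; rewrite /= in_itv/= => /andP[xz zy].
by rewrite /oitv/= (lt_le_trans ax) ?lee_fin//= (le_lt_trans _ yb) ?lee_fin.
Qed.

(** Integrability gives finiteness a.e. on each compact interval, and countably many of them exhaust
    I. *)
Lemma locally_integrable_fin a b (u : R -> \bar R) : (a < b)%E ->
  locally_integrable_weight a b u ->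
  {ae mu, forall x, oitv a b x -> u x \is a fin_num}.
Proof.
move=> /oitv_exhaustion[c [d [cI dI cd cov]]] ui.
have /ae_foralln : forall n, {ae mu, forall x, `[c n, d n]%classic x -> u x \is a fin_num}.
  move=> n; apply: integrable_ae => //.
  by apply: ui; [exact: itv_sub_oitv|exact: segment_compact].
apply: (@filterS _ _ (ae_filter_ringOfSetsType _)) => x ux /cov[n _ /(_ n (leqnn n))].
exact: ux.
Qed.

End Intervals.

(** * Sets escaping to an endpoint of the interval *)

(** Common form of (a, c) as c decreases to a and (d, b) as d increases to b: the sets eventually
    miss each compact subinterval of I. Both ends are then served by the same lemmas. *)
Definition escaping (R : realType) (a b : \bar R) (G : set_system R) (E : R -> set R) :=
  forall x y, oitv a b x -> oitv a b y -> \forall c \near G, E c `&` `[x, y] = set0.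

Lemma escaping_left (R : realType) (a b : \bar R) :
  escaping a b (decr_to a) (fun c => oitv a c%:E).
Proof.
move=> x y /andP[ax _] _; have := near_decr_to ax; apply: filterS => c /andP[_ cx].
apply/seteqP; split => // z [/andP[_ zc]]; rewrite /= in_itv/= => /andP[xz _].
by move: (lt_trans zc cx); rewrite lte_fin ltNge xz.
Qed.

Lemma escaping_right (R : realType) (a b : \bar R) :
  escaping a b (incr_to b) (fun d => oitv d%:E b).
Proof.
move=> x y _ /andP[_ yb]; have := near_incr_to yb; apply: filterS => c /andP[yc _].
apply/seteqP; split => // z [/andP[cz _]]; rewrite /= in_itv/= => /andP[_ zy].
by move: (lt_trans yc cz); rewrite lte_fin ltNge zy.
Qed.

(** By dominated convergence the mass outside [[c n, d n]] tends to 0; once it is below [e] for some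
    n, it suffices that [E] misses that one interval. *)
Lemma pint_escaping (R : realType) (s : scalars) (a b : \bar R) (p : R) (w : R -> \bar R)
    (G : set_system R) (E : R -> set R) (h : R -> Defs.scalar R s) (e : R) :
  (a < b)%E -> Filter G -> 0 < p -> measurable_fun (oitv a b) w ->
  scalar_measurable_fun (oitv a b) h -> (forall c, measurable (E c)) ->
  escaping a b G E -> (pint p w (oitv a b) h < +oo)%E -> 0 < e ->
  \forall c \near G, (pint p w (oitv a b `&` E c) h < e%:E)%E.
Proof.
move=> ab FG p0 mw mh mE esc hfin e0.
have mI := measurable_oitv a b.
have [c [d [cI dI cd cov]]] := oitv_exhaustion ab.
pose f x := ((modulus (h x) `^ p)%:E * `|w x|)%E.
have f0 x : (0 <= f x)%E by rewrite /f mule_ge0// lee_fin powR_ge0.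
have mf : measurable_fun (oitv a b) f by exact: measurable_pintegrand.
pose T n := oitv a b `\` `[c n, d n].
have mT n : measurable (T n) by apply: measurableD => //; exact: measurable_itv.
have : (fun n => pint p w (T n) h) @ \oo --> 0%E.
  have -> : (fun n => pint p w (T n) h) =
      fun n => (\int[@lebesgue_measure R]_(x in oitv a b) (f \_ (~` `[c n, d n])) x)%E.
    by apply/funext => n; rewrite pintE /T setDE integral_mkcondr.
  rewrite -[X in _ --> X](integral0 (@lebesgue_measure R) (oitv a b)).
  have mfn n : measurable_fun (oitv a b) (f \_ (~` `[c n, d n])).
    by apply/measurable_restrict => //; [exact: measurableC|exact: measurable_funS mf].
  have m0 : measurable_fun (oitv a b) (cst (0 : \bar R)%E) by exact: measurable_cst.
  have f0cvg : {ae @lebesgue_measure R, forall x, oitv a b x ->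
      (f \_ (~` `[c n, d n])) x @[n --> \oo] --> (0 : \bar R)%E}.
    apply: aeW => x /cov cx; apply: cvg_near_cst; apply: filterS cx => n cx.
    by rewrite patchE memNset//= => /(_ cx).
  have fi : (@lebesgue_measure R).-integrable (oitv a b) f.
    apply/integrableP; split => //; rewrite pintE in hfin.
    by under eq_integral do rewrite gee0_abs ?f0//.
  have fle : {ae @lebesgue_measure R, forall x n, oitv a b x ->
      (`|(f \_ (~` `[c n, d n])) x| <= f x)%E}.
    apply: aeW => x n _; rewrite patchE; case: ifP => _; rewrite ?gee0_abs//.
  have [] := @dominated_convergence _ _ R (@lebesgue_measure R) (oitv a b) mI
    (fun n => f \_ (~` `[c n, d n])) (cst 0%E) f mfn m0 _ fi fle.
    exact: f0cvg.
  by [].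
have e0' : (0 < e%:E)%E by rewrite lte_fin.
move=> /(_ _ (open_ereal_lt' e0'))[n _ /(_ n (leqnn n)) /= Tn].
have := esc _ _ (cI n) (dI n); apply: filterS => t Et.
apply: le_lt_trans Tn; apply: subset_pint => //.
- exact: measurableI.
- by apply: measurable_funS mw => // x [].
- by apply: scalar_measurableS mh => // x [].
- move=> x [Ix Etx]; split => // cdx; have : set0 x by rewrite -Et.
  by [].
Qed.

(** * The spaces L^p *)

(** A weight is nonnegative only almost everywhere, whereas [pint] uses its absolute value so that
    the integrand is nonnegative at every point; the two integrals agree. *)
Lemma wnormE (R : realType) (s : scalars) (a b : \bar R) (q : R) (w : R -> \bar R)
    (h : R -> Defs.scalar R s) : is_weight a b w -> scalar_measurable_fun (oitv a b) h ->
  wnorm a b q w h = poweR (pint q w (oitv a b) h) q^-1.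
Proof.
move=> [mw w0] mh; rewrite /wnorm pintE; congr poweR.
have mI := measurable_oitv a b.
apply: ae_eq_integral => //; last 2 first.
- exact: measurable_pintegrand.
- apply: (@filterS _ _ (ae_filter_ringOfSetsType _) _ _ _ w0) => x {}w0 Ix.
  by rewrite gee0_abs// w0.
apply: emeasurable_funM => //; apply/measurable_EFinP.
by apply: (measurableT_comp (measurable_powR _)); exact: scalar_measurable_modulus.
Qed.

Lemma wnorm_restrictE (R : realType) (s : scalars) (a b : \bar R) (q : R)
    (w : R -> \bar R) (E : set R) (h : R -> Defs.scalar R s) :
  is_weight a b w -> scalar_measurable_fun (oitv a b) h -> measurable E ->
  wnorm a b q (restrict_weight w E) h = poweR (pint q w (oitv a b `&` E) h) q^-1.
Proof.
move=> [mw w0] mh mE; have mI := measurable_oitv a b.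
rewrite /wnorm pintE integral_mkcondr; congr poweR.
have mh' : measurable_fun (oitv a b) (fun x => (modulus (h x) `^ q)%:E).
  apply/measurable_EFinP.
  by apply: (measurableT_comp (measurable_powR _)); exact: scalar_measurable_modulus.
apply: ae_eq_integral => //.
- apply: emeasurable_funM => //; apply: emeasurable_funM => //.
  by apply/measurable_EFinP; exact: measurable_indic.
- apply/measurable_restrict => //; apply: measurable_funS (measurable_pintegrand q mw mh) => //.
apply: (@filterS _ _ (ae_filter_ringOfSetsType _) _ _ _ w0) => x {}w0 Ix.
rewrite /restrict_weight patchE indicE.
by case: ifP => _; rewrite ?mule1 ?mule0 ?gee0_abs ?w0.
Qed.

Section Lp_theory.
Local Open Scope quotient_scope.
Variables (R : realType) (s : scalars) (a b : \bar R) (p : {posnum R}) (w : weight a b).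
Local Notation mu := (@lebesgue_measure R).
Local Notation I := (oitv a b).
Local Notation Y := (Lp s p w).
Local Notation K := (Defs.scalar R s).
Local Notation J := (@pint R s p%:num w).
Local Notation r := (gauge_exp p%:num).
Implicit Types f g h : Y.

Let p0 : 0 < p%:num. Proof. by []. Qed.
Let mI : measurable I. Proof. exact: measurable_oitv. Qed.
Let mw : measurable_fun I w. Proof. exact: (weightP w).1. Qed.
Let mwD E : measurable E -> measurable_fun (I `&` E) w.
Proof. by move=> mE; apply: measurable_funS mw => // x []. Qed.

Lemma LfunctionsP (f : R -> K) : f \in Lfunctions p w <->
  scalar_measurable_fun I f /\ (J I f < +oo)%E.
Proof.
split => [/asboolP[mf]|[mf fi]].
  rewrite wnormE//; last exact: weightP.
  by move=> /lty_poweRy fi; split => //; apply: fi; rewrite invr_eq0 gt_eqF.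
apply/asboolP; split => //; rewrite wnormE//; last exact: weightP.
exact: poweR_lty.
Qed.

Lemma Lp_fun_measurable f : scalar_measurable_fun I (Lp_fun f).
Proof. by have /LfunctionsP[] := valP (repr f : Defs.Lfun s p w). Qed.

Lemma Lp_fun_lty f : (J I (Lp_fun f) < +oo)%E.
Proof. by have /LfunctionsP[] := valP (repr f : Defs.Lfun s p w). Qed.

Lemma Lp_normE f : Lp_norm f = poweR (J I (Lp_fun f)) (p%:num)^-1.
Proof. by rewrite /Lp_norm wnormE//; [exact: weightP|exact: Lp_fun_measurable]. Qed.

(** [repr] may return any member of the class, so the chosen representative is controlled only
    almost everywhere and only where [w] does not vanish. *)
Lemma Lp_fun_pi (f : Defs.Lfun s p w) : ae_eq_weight w (Lp_fun (\pi_Y f)) (val f).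
Proof.
have : (repr (\pi_Y f) : Defs.Lfun s p w) - f \in @Lnull R s a b p w.
  by rewrite Quotient.idealrBE reprK.
move=> /asboolP; apply: (@filterS _ _ (ae_filter_ringOfSetsType _)) => x fx Ix wx.
by apply/eqP; rewrite -subr_eq0; apply/eqP; exact: fx.
Qed.

Lemma Lp_eq f g : ae_eq_weight w (Lp_fun f) (Lp_fun g) -> f = g.
Proof.
move=> fg; rewrite -[f]reprK -[g]reprK; apply/eqP; rewrite -Quotient.idealrBE.
apply/asboolP; apply: (@filterS _ _ (ae_filter_ringOfSetsType _) _ _ _ fg) => x {}fg Ix wx.
by rewrite /= fctE; apply/eqP; rewrite subr_eq0; apply/eqP; exact: fg.
Qed.

Lemma Lp_funP (c : K) f g : ae_eq_weight w (Lp_fun (c *: f + g))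
  (fun x => c * Lp_fun f x + Lp_fun g x).
Proof.
have -> : c *: f + g = \pi_Y (c *: (repr f : Defs.Lfun s p w) + (repr g : Defs.Lfun s p w)).
  by rewrite raddfD/= reprK; congr (_ + _); rewrite -Lp_scaleE reprK.
exact: Lp_fun_pi.
Qed.

Lemma Lp_funZ (c : K) f : ae_eq_weight w (Lp_fun (c *: f)) (fun x => c * Lp_fun f x).
Proof.
have -> : c *: f = \pi_Y (c *: (repr f : Defs.Lfun s p w)) by rewrite -Lp_scaleE reprK.
exact: Lp_fun_pi.
Qed.

Lemma Lp_funB f g : ae_eq_weight w (Lp_fun (f - g)) (fun x => Lp_fun f x - Lp_fun g x)%R.
Proof.
have -> : f - g = (-1) *: g + f by rewrite scaleN1r addrC.
apply: (@filterS _ _ (ae_filter_ringOfSetsType _) _ _ _ (Lp_funP (-1) g f)) => x fg Ix wx.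
by rewrite fg// mulN1r addrC.
Qed.

Lemma Lp_distE f g : poweR (Lp_norm (f - g)) (Num.min 1 p%:num) =
  poweR (J I (fun x => Lp_fun f x - Lp_fun g x)%R) r.
Proof.
rewrite Lp_normE gaugeE; congr poweR; apply: ae_eq_pint => //.
- exact: Lp_fun_measurable.
- by apply: scalar_measurableB; exact: Lp_fun_measurable.
- exact: Lp_funB.
Qed.

Let dist f g := poweR (J I (fun x => Lp_fun f x - Lp_fun g x)%R) r.

(** Open sets are defined as those containing a ball around each of their points; that balls are
    themselves open is the triangle inequality, with radius [e] minus the distance to the centre. *)
Lemma Lp_nbhs_ball f (e : R) : 0 < e -> \forall g \near f,
  (poweR (J I (fun x => Lp_fun f x - Lp_fun g x)%R) r < e%:E)%E.
Proof.
move=> e0; suff : open_nbhs f [set g | (dist f g < e%:E)%E] by move=> /open_nbhs_nbhs.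
split; last first.
  rewrite /= /dist (_ : (fun x => _) = cst 0); last by apply/funext => x; rewrite subrr.
  rewrite (_ : J I (cst 0) = 0%E).
    by rewrite poweR0r ?lte_fin// gt_eqF// gauge_exp_gt0.
  by rewrite pintE integral0_eq// => x _; rewrite modulus0 powR0 ?gt_eqF// mul0e.
move=> g /= fg.
have dfin : dist f g \is a fin_num.
  by rewrite ge0_fin_numE ?poweR_ge0//; exact: lt_trans fg (ltry _).
exists (e - fine (dist f g)).
  by rewrite subr_gt0 -lte_fin fineK.
move=> h; rewrite Lp_distE => gh /=; rewrite /dist.
apply: le_lt_trans (_ : (dist f g + dist g h < _)%E).
  apply: gauge_triangle => //; try by apply: scalar_measurableB; exact: Lp_fun_measurable.
  by move=> x _; rewrite addrA subrK.
by rewrite addeC -lteBrDr// (lt_le_trans gh)// EFinB fineK.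
Qed.

Lemma Lp_nbhsP f (U : set Y) : nbhs f U -> exists2 e : R, 0 < e &
  forall g, (poweR (J I (fun x => Lp_fun f x - Lp_fun g x)%R) r < e%:E)%E -> U g.
Proof.
rewrite nbhsE => -[V [oV Vf] VU].
have [e e0 eV] := (oV : Lp_open V) f Vf; exists e => // g fg; apply/VU/eV.
by rewrite Lp_distE.
Qed.

Lemma Lp_hausdorff : hausdorff_space Y.
Proof.
move=> f g fg; apply: Lp_eq.
have : dist f g = 0%E.
  apply/eqP; rewrite eq_le poweR_ge0 andbT; apply/lee_addgt0Pr => e e0.
  have e20 : 0 < e / 2 by rewrite divr_gt0.
  have [h [fh gh]] := fg _ _ (Lp_nbhs_ball f e20) (Lp_nbhs_ball g e20).
  rewrite add0e [e]splitr EFinD; apply: le_trans (leeD (ltW fh) (ltW gh)).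
  rewrite (_ : J I (fun x => Lp_fun g x - Lp_fun h x)%R = J I (fun x => Lp_fun h x - Lp_fun g x)%R).
    apply: gauge_triangle => //; try by apply: scalar_measurableB; exact: Lp_fun_measurable.
    by move=> x _; rewrite addrA subrK.
  rewrite !pintE; apply: eq_integral => x _.
  by rewrite -[in LHS]modulusN opprB.
move=> /poweR_eq0_eq0 => /(_ (pint_ge0 _ _ _ _)) fg0.
have := pint_eq0 p0 mI mw _ fg0.
move=> /(_ (scalar_measurableB (Lp_fun_measurable f) (Lp_fun_measurable g))).
apply: (@filterS _ _ (ae_filter_ringOfSetsType _)) => x {}fg Ix wx.
by apply/eqP; rewrite -subr_eq0; apply/eqP; exact: fg.
Qed.

(** In the near-covering form of compactness, uniformity over [S] follows from a joint statement
    near each single [y]: for z close to y, the tail of z is at most the distance from y to z plus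
    the tail of y. *)
Lemma compact_escaping (S : set Y) (G : set_system R) (E : R -> set R) (e : R) :
  (a < b)%E -> Filter G -> (forall c, measurable (E c)) -> escaping a b G E ->
  compact S -> 0 < e ->
  \forall c \near G, forall y, S y -> (poweR (J (I `&` E c) (Lp_fun y)) r < e%:E)%E.
Proof.
move=> ab FG mE esc /compact_near_coveringP cS e0.
apply: (cS _ _ (fun c y => (poweR (J (I `&` E c) (Lp_fun y)) r < e%:E)%E)) => // y Sy.
have e20 : 0 < e / 2 by rewrite divr_gt0.
have r0 := gauge_exp_gt0 p0.
(* The bound on the integral that becomes [e / 2] after raising to the power [r]. *)
have eV : 0 < (e / 2) `^ r^-1 by rewrite powR_gt0.
have tail := pint_escaping ab FG p0 mw (Lp_fun_measurable y) mE esc (Lp_fun_lty y) eV.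
near=> z c => /=.
have mIE : measurable (I `&` E c) by exact: measurableI.
have mS f : scalar_measurable_fun (I `&` E c) (Lp_fun f).
  by apply: scalar_measurableS (Lp_fun_measurable f) => // x [].
apply: (@le_lt_trans _ _ (poweR (J (I `&` E c) (fun x => Lp_fun y x - Lp_fun z x)%R) r +
    poweR (J (I `&` E c) (Lp_fun y)) r)%E).
  rewrite (_ : J (I `&` E c) (fun x => Lp_fun y x - Lp_fun z x)%R =
      J (I `&` E c) (fun x => Lp_fun z x - Lp_fun y x)%R); last first.
    by rewrite !pintE; apply: eq_integral => x _; rewrite -[in LHS]modulusN opprB.
  apply: gauge_triangle => //; [exact: mwD|by apply: scalar_measurableB|].
  by move=> x _; rewrite subrK.
rewrite [e]splitr EFinD; apply: lteD.
  apply: (@le_lt_trans _ _ (dist y z)); last by near: z; exact: Lp_nbhs_ball.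
  apply: le_gauge; rewrite ?(ltW r0) ?pint_ge0//; apply: subset_pint => //.
  by apply: scalar_measurableB; exact: Lp_fun_measurable.
have : (J (I `&` E c) (Lp_fun y) < ((e / 2) `^ r^-1)%:E)%E by near: c.
have Jfin : J (I `&` E c) (Lp_fun y) \is a fin_num.
  rewrite ge0_fin_numE ?pint_ge0//; apply: le_lt_trans (Lp_fun_lty y).
  by apply: subset_pint => //; exact: Lp_fun_measurable.
rewrite -(fineK Jfin) poweR_EFin !lte_fin => Jlt.
rewrite -[ltRHS](powRVK (lt0r_neq0 r0) (ltW e20)).
by rewrite gt0_ltr_powR ?nnegrE ?powR_ge0 ?fine_ge0 ?pint_ge0.
Unshelve. all: by end_near. Qed.

(** Near-covering again, now with the filter of large integers: each [y] has a neighbourhood on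
    which every large enough [n] is a bound. *)
Lemma compact_bounded (S : set Y) : compact S ->
  exists M : R, forall y, S y -> (J I (Lp_fun y) <= M%:E)%E.
Proof.
move=> /compact_near_coveringP cS.
have r0 := gauge_exp_gt0 p0.
have := cS _ (\oo : set_system nat)
  (fun n y => (poweR (J I (Lp_fun y)) r <= n%:R%:E)%E) _ _.
case=> // [y Sy|n _ /(_ n (leqnn n)) Sn].
  have Jy := Lp_fun_lty y.
  have Jfin : poweR (J I (Lp_fun y)) r \is a fin_num.
    by rewrite ge0_fin_numE ?poweR_ge0// poweR_lty.
  near=> z n => /=.
  apply: (@le_trans _ _ (dist y z + poweR (J I (Lp_fun y)) r)%E).
    rewrite /dist (_ : J I (fun x => Lp_fun y x - Lp_fun z x)%R =
      J I (fun x => Lp_fun z x - Lp_fun y x)%R); last first.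
      by rewrite !pintE; apply: eq_integral => x _; rewrite -[in LHS]modulusN opprB.
    apply: gauge_triangle => //; try exact: Lp_fun_measurable.
      by apply: scalar_measurableB; exact: Lp_fun_measurable.
    by move=> x _; rewrite subrK.
  apply: (@le_trans _ _ (1 + (fine (poweR (J I (Lp_fun y)) r))%:E)%E).
    apply: leeD; last by rewrite fineK.
    by apply: ltW; near: z; exact: Lp_nbhs_ball.
  by rewrite -EFinD lee_fin; near: n; exact: nbhs_infty_ger.
exists (n%:R `^ r^-1) => y /Sn.
have Jfin : J I (Lp_fun y) \is a fin_num.
  by rewrite ge0_fin_numE ?pint_ge0// Lp_fun_lty.
rewrite -(fineK Jfin) poweR_EFin !lee_fin => Jle.
rewrite -[leLHS](powRKV (lt0r_neq0 r0) (fine_ge0 (pint_ge0 _ _ _ _))).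
by rewrite ge0_ler_powR ?nnegrE ?powR_ge0 ?invr_ge0 ?(ltW r0).
Unshelve. all: by end_near. Qed.

End Lp_theory.

(** * The Hardy operator on the unit ball *)

Definition part (R : realType) (s : scalars) (j : bool) (z : Defs.scalar R s) : R :=
  if j then re_part z else im_part z.

Lemma part_le_modulus (R : realType) (s : scalars) j (z : Defs.scalar R s) :
  `|part j z| <= modulus z.
Proof. by case: j; [exact: modulus_ge_re|exact: modulus_ge_im]. Qed.

Lemma measurable_part (R : realType) (s : scalars) j (D : set R) (f : R -> Defs.scalar R s) :
  scalar_measurable_fun D f -> measurable_fun D (fun x => part j (f x)).
Proof. by case: j => -[]. Qed.

(** For real scalars the imaginary part is 0 on both sides. *)
Lemma part_scalar_integral (R : realType) (s : scalars) j (D : set R)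
    (f : R -> Defs.scalar R s) :
  part j (scalar_integral D f) = \int[@lebesgue_measure R]_(x in D) part j (f x).
Proof.
case: s f => f; case: j => //=; rewrite /Rintegral integral0_eq//.
Qed.

(** Young's inequality for the factors (l c)^(1/p) m and (l c)^(-1/p), whose product is m. The
    denominators p and p' exceed 1 and are dropped, and -p'/p = 1 - p' gives the second exponent. *)
Lemma young_powR (R : realType) (p p' l m c : R) : 1 < p -> p^-1 + p'^-1 = 1 ->
  0 < l -> 0 <= m -> 0 < c ->
  m <= l * (m `^ p * c) + l `^ (1 - p') * c `^ (1 - p').
Proof.
move=> p1 pp' l0 m0 c0.
have p0 : 0 < p by rewrite (lt_trans ltr01).
have p'V : p'^-1 = 1 - p^-1 by rewrite -pp' addrAC subrr add0r.
have p'V01 : 0 < p'^-1 <= 1.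
  by rewrite p'V subr_gt0 invf_lt1// p1/= gerBl invr_ge0 ltW.
have p'0 : 0 < p' by rewrite -invr_gt0; case/andP: p'V01.
have p'1 : 1 <= p' by rewrite -[p']invrK invf_ge1 ?invr_gt0//; case/andP: p'V01.
have lc0 : 0 < l * c by rewrite mulr_gt0.
have := @conjugate_powR R ((l * c) `^ p^-1 * m) ((l * c) `^ (- p^-1)) p p'.
rewrite mulr_ge0 ?powR_ge0// => /(_ isT isT p0 p'0 pp').
rewrite powRN mulrAC divff ?gt_eqF ?powR_gt0// mul1r => /le_trans; apply.
apply: lerD.
  rewrite powRM ?powR_ge0// powRVK ?gt_eqF ?(ltW lc0)//.
  rewrite ler_pdivrMr// (mulrC (m `^ p)) mulrA ler_peMr ?(ltW p1)//.
  by rewrite mulr_ge0 ?powR_ge0// ltW.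
rewrite -powRN -powRM ?(ltW l0) ?(ltW c0)// -powRrM.
have -> : - p^-1 * p' = 1 - p'.
  have -> : - p^-1 = p'^-1 - 1 by rewrite p'V addrAC subrr add0r.
  by rewrite mulrBl mulVf ?gt_eqF// mul1r.
by rewrite ler_pdivrMr// ler_peMr// powR_ge0.
Qed.

Section Hardy_theory.
Variables (R : realType) (s : scalars) (a b : \bar R) (p : {posnum R}) (p' : R).
Variable v : weight a b.
Local Notation mu := (@lebesgue_measure R).
Local Notation I := (oitv a b).
Local Notation K := (Defs.scalar R s).
Local Notation J := (@pint R s p%:num v).
Hypothesis p1 : 1 < p%:num.
Hypothesis pp' : (p%:num)^-1 + p'^-1 = 1.
Hypothesis v0 : {ae mu, forall x, I x -> (0 < v x < +oo)%E}.
Hypothesis vfin : forall x, I x ->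
  (\int[mu]_(t in oitv a x%:E) poweR (v t) (1 - p') < +oo)%E.
Implicit Types (f g : R -> K).

Let p0 : 0 < p%:num. Proof. by []. Qed.
Let mI : measurable I. Proof. exact: measurable_oitv. Qed.
Let mv : measurable_fun I v. Proof. exact: (weightP v).1. Qed.

(** The density of V, made real-valued by [fine]; as [v] is positive and finite a.e., this changes
    it only on a null set. *)
Definition dual_weight t := fine (v t) `^ (1 - p').

Lemma measurable_dual_weight : measurable_fun I dual_weight.
Proof.
apply: (measurableT_comp (measurable_powR _)).
by apply: measurableT_comp; first exact: fine_measurable.
Qed.

Lemma oitvS x : I x -> oitv a x%:E `<=` I.
Proof. by move=> /andP[_ xb] t /andP[at_ tx]; rewrite /oitv/= at_ (lt_trans tx). Qed.

Lemma integrable_dual_weight x : I x -> mu.-integrable (oitv a x%:E) (EFin \o dual_weight).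
Proof.
move=> Ix; have mo := @measurable_oitv R a x%:E.
have md := measurable_funS mI (oitvS Ix) measurable_dual_weight.
apply/integrableP; split; first exact/measurable_EFinP.
apply: le_lt_trans (vfin Ix); rewrite le_eqVlt; apply/orP; left; apply/eqP.
apply: ae_eq_integral => //.
- by apply: measurableT_comp => //; exact/measurable_EFinP.
- apply: (measurableT_comp (measurable_poweR _)).
  exact: measurable_funS (oitvS Ix) mv.
apply: (@filterS _ _ (ae_filter_ringOfSetsType _) _ _ _ v0) => t vt /(oitvS Ix)/vt.
move=> /andP[t0 ty]; rewrite /= ger0_norm ?powR_ge0// -poweR_EFin fineK//.
by rewrite ge0_fin_numE ?ltW.
Qed.

Lemma integral_modulus_le (E : set R) f (l : R) : measurable E -> E `<=` I ->
  scalar_measurable_fun I f -> 0 < l ->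
  (\int[mu]_(x in E) (modulus (f x))%:E <= l%:E * J E f +
    (l `^ (1 - p'))%:E * \int[mu]_(x in E) (dual_weight x)%:E)%E.
Proof.
move=> mE EI mf l0.
have mfE := scalar_measurableS mI EI mf.
have mvE := measurable_funS mI EI mv.
have mgE : measurable_fun E (EFin \o dual_weight).
  by apply/measurable_EFinP; exact: measurable_funS EI measurable_dual_weight.
have dw0 x : (0 <= (dual_weight x)%:E)%E by rewrite lee_fin powR_ge0.
have l'0 : (0 <= (l `^ (1 - p'))%:E)%E by rewrite lee_fin powR_ge0.
have l0' : (0 <= l%:E)%E by rewrite lee_fin ltW.
rewrite pintE -ge0_integralZl//; last 2 first.
- exact: measurable_pintegrand.
- by move=> x _; exact: pintegrand_ge0.
rewrite -ge0_integralZl// -ge0_integralD//; last 4 first.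
- by move=> x _; rewrite mule_ge0// pintegrand_ge0.
- by apply: emeasurable_funM => //; exact: measurable_pintegrand.
- by move=> x _; rewrite mule_ge0.
- by apply: emeasurable_funM.
apply: ae_ge0_le_integral => //.
- by move=> x _; rewrite lee_fin modulus_ge0.
- by apply/measurable_EFinP; exact: scalar_measurable_modulus.
- by move=> x _; rewrite adde_ge0// mule_ge0// pintegrand_ge0.
- apply: emeasurable_funD; apply: emeasurable_funM => //; exact: measurable_pintegrand.
apply: (@filterS _ _ (ae_filter_ringOfSetsType _) _ _ _ v0) => x vx /EI/vx/andP[x0 xy].
have vE : v x = (fine (v x))%:E by rewrite fineK// ge0_fin_numE ?ltW.
rewrite (gee0_abs (ltW x0)) vE -!EFinM -EFinD lee_fin.
apply: young_powR; rewrite ?modulus_ge0//.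
by rewrite -lte_fin -vE.
Qed.

Lemma integrable_part x f j : I x -> scalar_measurable_fun I f -> (J I f < +oo)%E ->
  mu.-integrable (oitv a x%:E) (EFin \o (fun t => part j (f t))).
Proof.
move=> Ix mf fi; have mo := @measurable_oitv R a x%:E.
have mfo := scalar_measurableS mI (oitvS Ix) mf.
apply/integrableP; split; first by apply/measurable_EFinP; exact: measurable_part.
apply: (@le_lt_trans _ _ (\int[mu]_(t in oitv a x%:E) (modulus (f t))%:E)%E).
  apply: ge0_le_integral => //.
  - by apply: measurableT_comp => //; apply/measurable_EFinP; exact: measurable_part.
  - by apply/measurable_EFinP; exact: scalar_measurable_modulus.
  - by move=> t _; rewrite /= lee_fin part_le_modulus.
apply: le_lt_trans (integral_modulus_le mo (oitvS Ix) mf ltr01) _.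
rewrite powR1 !mul1e lte_add_pinfty//.
  by apply: le_lt_trans fi; apply: subset_pint => //; exact: oitvS.
have /integrableP[_] := integrable_dual_weight Ix.
by under eq_integral do rewrite /= ger0_norm ?powR_ge0//.
Qed.

Lemma norm_integral_part_le (E : set R) x f j (l : R) : I x -> measurable E ->
  E `<=` oitv a x%:E -> scalar_measurable_fun I f -> (J I f < +oo)%E -> 0 < l ->
  `|\int[mu]_(t in E) part j (f t)| <= l * fine (J I f) +
    l `^ (1 - p') * \int[mu]_(t in E) dual_weight t.
Proof.
move=> Ix mE Eo mf fi l0; have EI := subset_trans Eo (oitvS Ix).
have mo := @measurable_oitv R a x%:E.
have fE := @integrableS _ _ R mu _ _ _ mo mE Eo (integrable_part j Ix mf fi).
have dE := @integrableS _ _ R mu _ _ _ mo mE Eo (integrable_dual_weight Ix).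
rewrite -lee_fin EFin_normr_Rintegral//.
apply: le_trans (le_abse_integral _ _ _) _ => //; first by case/integrableP: fE.
apply: (@le_trans _ _ (\int[mu]_(t in E) (modulus (f t))%:E)%E).
  have mfE := scalar_measurableS mI EI mf.
  apply: ge0_le_integral => //.
  - by apply: measurableT_comp => //; case/integrableP: fE.
  - by apply/measurable_EFinP; exact: scalar_measurable_modulus.
  - by move=> t _; rewrite /= lee_fin part_le_modulus.
apply: le_trans (integral_modulus_le mE EI mf l0) _.
rewrite EFinD !EFinM fineK; last by rewrite ge0_fin_numE ?pint_ge0.
rewrite /Rintegral fineK; last exact: integrable_fin_num.
apply: leeD => //; rewrite lee_wpmul2l ?lee_fin ?(ltW l0)//.
exact: subset_pint.
Qed.

(** The parameter l = 1 yields the bound 1 + V(x). *)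
Lemma Hardy_bounded x : I x -> exists M : R, forall f j,
  scalar_measurable_fun I f -> (J I f <= 1)%E -> `|part j (Hardy a f x)| <= M.
Proof.
move=> Ix; exists (1 + \int[mu]_(t in oitv a x%:E) dual_weight t) => f j mf f1.
have fi : (J I f < +oo)%E by apply: le_lt_trans f1 (ltry _).
rewrite part_scalar_integral.
have := norm_integral_part_le j Ix (@measurable_oitv R a x%:E) (@subset_refl _ _) mf fi ltr01.
move=> /le_trans; apply; rewrite powR1 !mul1r lerD2r -lee_fin fineK//.
by rewrite ge0_fin_numE ?pint_ge0.
Qed.

(** The difference of two values is an integral over a short interval. One half of [e] pays for the
    term with f, uniformly in f, and the other for the integral of the dual weight, which is
    absolutely continuous. *)
Lemma Hardy_equicontinuous (M e : R) x : I x -> 0 < M -> 0 < e ->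
  \forall y \near x, forall f j, scalar_measurable_fun I f -> (J I f <= M%:E)%E ->
    `|part j (Hardy a f y) - part j (Hardy a f x)| <= e.
Proof.
move=> Ix M0 e0.
have /andP[ax xb] := Ix; have PF := incr_to_proper xb.
(* A point to the right of x leaves room for y > x while the dual weight is still integrable on (a,
   x1). *)
have [x1 /andP[xx1 x1b]] := filter_ex (near_incr_to xb).
have Ix1 : I x1 by rewrite /oitv/= x1b andbT (lt_trans ax).
rewrite lte_fin in xx1.
(* With this l, the term l times the integral of |f|^p v is at most [e / 2] as soon as that integral
   is at most [M]. *)
pose l := e / 2 / M.
have l0 : 0 < l by rewrite !divr_gt0.
pose l' := l `^ (1 - p').
have l'0 : 0 < l' by rewrite powR_gt0.
have mo := @measurable_oitv R a x1%:E.
have di := integrable_dual_weight Ix1.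
have gi : mu.-integrable setT (EFin \o (dual_weight \_ (oitv a x1%:E))).
  by rewrite -restrict_EFin; apply/integrable_restrict => //; rewrite setTI.
have el' : 0 < e / 2 / l' by rewrite !divr_gt0.
have [d [d0 dP]] := integral_normr_continuous gi el'.
(* Stated for an ordered pair, so that it covers points on either side of x. *)
have key y z f j : I y -> y <= z -> z < x1 -> z - y < d -> scalar_measurable_fun I f ->
    (J I f <= M%:E)%E -> `|part j (Hardy a f z) - part j (Hardy a f y)| <= e.
  move=> Iy yz zx1 zyd mf fM.
  have fi : (J I f < +oo)%E by apply: le_lt_trans fM (ltry _).
  have Iz : I z.
    by apply: (itv_sub_oitv Iy Ix1); rewrite /= in_itv/= yz ltW.
  have /andP[ay _] := Iy.
  have myz : measurable `[y, z[%classic by exact: measurable_itv.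
  have zE : oitv a z%:E = oitv a y%:E `|` `[y, z[%classic.
    apply/seteqP; split=> [t /andP[ta tz]|t [/andP[ta ty]|]].
    - have [ty|yt] := ltP t y; first by left; rewrite /oitv/= ta lte_fin.
      by right; rewrite /= in_itv/= yt -lte_fin.
    - by rewrite /oitv/= ta (lt_le_trans ty).
    - rewrite /= in_itv/= => /andP[yt tz]; rewrite /oitv/= lte_fin tz andbT.
      by apply: lt_le_trans ay _; rewrite lee_fin.
  have yzx1 : `[y, z[%classic `<=` oitv a x1%:E.
    move=> t; rewrite /= in_itv/= => /andP[yt tz]; rewrite /oitv/= lte_fin (lt_trans tz)// andbT.
    by apply: lt_le_trans ay _; rewrite lee_fin.
  rewrite !part_scalar_integral zE Rintegral_setU//; last 3 first.
  - exact: measurable_oitv.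
  - by rewrite -zE; exact: integrable_part.
  - apply/disj_setPS => t [/andP[_]]; rewrite lte_fin => ty.
    by rewrite /= in_itv/= leNgt ty.
  rewrite addrAC subrr add0r.
  apply: le_trans (norm_integral_part_le j Ix1 myz yzx1 mf fi l0) _.
  rewrite [leRHS]splitr; apply: lerD.
    rewrite /l mulrAC ler_pdivrMr// ler_wpM2l ?divr_ge0 ?(ltW e0)//.
    by rewrite -lee_fin fineK// ge0_fin_numE ?pint_ge0.
  rewrite -ler_pdivlMl// mulrC; apply: ltW; apply: le_lt_trans (dP `[y, z[%classic myz _).
    rewrite le_eqVlt; apply/orP; left; apply/eqP; apply: eq_Rintegral => t.
    rewrite inE => /yzx1 t1; rewrite patchE mem_set// ger0_norm ?powR_ge0//.
  have : (mu `[y, z[%classic < d%:E)%E.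
    rewrite lebesgue_measure_itv/=; case: ifP => _; last by rewrite lte_fin.
    by rewrite -EFinB lte_fin.
  exact.
near=> y => f j mf fM.
have Iy : I y by near: y; exact: open_nbhs_nbhs (conj (@open_oitv _ _ _) Ix).
have yx1 : y < x1 by near: y; exact: lt_nbhsl.
have : `|x - y| < d by near: y; exact: cvgr_dist_lt.
have [xy|yx] := leP x y.
  rewrite ler0_norm ?subr_le0// opprB => yxd; exact: key.
rewrite ger0_norm ?subr_ge0 ?(ltW yx)// => xyd; rewrite distrC; apply: key => //; exact: ltW.
Unshelve. all: by end_near. Qed.

(** Equicontinuity applied to f alone gives continuity on the open set I, hence measurability;
    adding 1 to the integral makes the radius positive. *)
Lemma Hardy_measurable f : scalar_measurable_fun I f -> (J I f < +oo)%E ->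
  scalar_measurable_fun I (Hardy a f).
Proof.
move=> mf fi.
have mpart j : measurable_fun I (fun x => part j (Hardy a f x)).
  apply: open_continuous_measurable_fun; first exact: open_oitv.
  move=> x /set_mem Ix; apply/cvgrPdist_le => e e0.
  have M0 : 0 < fine (J I f) + 1 by rewrite ltr_wpDl// fine_ge0// pint_ge0.
  have := Hardy_equicontinuous Ix M0 e0; apply: filterS => y H.
  rewrite distrC; apply: H => //.
  rewrite EFinD fineK ?ge0_fin_numE ?pint_ge0//.
  by rewrite leeDl.
by split; [exact: (mpart true)|exact: (mpart false)].
Qed.

(** Since [v] is positive a.e., equality modulo the weight is equality a.e. on I; hence Hf depends
    only on the class of f. *)
Lemma Hardy_ae_eq f g x : I x -> scalar_measurable_fun I f -> scalar_measurable_fun I g ->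
  ae_eq_weight v f g -> Hardy a f x = Hardy a g x.
Proof.
move=> Ix mf mg fg.
have E j : part j (Hardy a f x) = part j (Hardy a g x).
  rewrite !part_scalar_integral /Rintegral; congr fine; apply: ae_eq_integral => //.
  - exact: measurable_oitv.
  - apply/measurable_EFinP; apply: measurable_part.
    exact: scalar_measurableS (oitvS Ix) mf.
  - apply/measurable_EFinP; apply: measurable_part.
    exact: scalar_measurableS (oitvS Ix) mg.
  apply: (@filterS2 _ _ (ae_filter_ringOfSetsType _) _ _ _ _ v0 fg) => t vt {}fg.
  move=> /(oitvS Ix) It; rewrite fg//; case/andP: (vt It) => + _.
  by rewrite lt0e => /andP[].
by apply: scalar_eq; [exact: (E true)|exact: (E false)].
Qed.

Lemma Hardy_linear f g (c : K) x : I x ->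
  scalar_measurable_fun I f -> (J I f < +oo)%E ->
  scalar_measurable_fun I g -> (J I g < +oo)%E ->
  Hardy a (fun t => c * f t + g t) x = c * Hardy a f x + Hardy a g x.
Proof.
move=> Ix mf fi mg gi; have mo := @measurable_oitv R a x%:E.
have fiP j := integrable_part j Ix mf fi.
have giP j := integrable_part j Ix mg gi.
have Zi (k : R) j : mu.-integrable (oitv a x%:E) (EFin \o (fun t => k * part j (f t))).
  by have := @integrableZl _ _ R mu _ mo k _ (fiP j); apply: eq_integrable.
have Bi (k l : R) i j : mu.-integrable (oitv a x%:E)
    (EFin \o (fun t => k * part i (f t) + l * part j (f t))).
  by have := @integrableD _ _ R mu _ mo _ _ (Zi k i) (Zi l j); apply: eq_integrable.
(* A complex factor mixes real and imaginary parts, so each part of c f + g is a combination of both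
   parts of f and one part of g. *)
have H (k l : R) i j m : \int[mu]_(t in oitv a x%:E)
    (k * part i (f t) + l * part j (f t) + part m (g t)) =
    k * part i (Hardy a f x) + l * part j (Hardy a f x) + part m (Hardy a g x).
  by rewrite !part_scalar_integral RintegralD// RintegralD// !RintegralZl.
apply: scalar_eq.
  rewrite re_partD re_partM -mulNr -(H _ _ true false true).
  rewrite -[LHS]/(part true (scalar_integral (oitv a x%:E) _)) part_scalar_integral; apply: eq_Rintegral => t _.
  by rewrite /part re_partD re_partM mulNr.
rewrite im_partD im_partM -(H _ _ false true false).
rewrite -[LHS]/(part false (scalar_integral (oitv a x%:E) _)) part_scalar_integral; apply: eq_Rintegral => t _.
by rewrite /part im_partD im_partM.
Qed.

Lemma Hardy_Lp_linear (c : K) (f g : Lp s p v) x : I x ->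
  Hardy a (Lp_fun (c *: f + g)) x = c * Hardy a (Lp_fun f) x + Hardy a (Lp_fun g) x.
Proof.
move=> Ix; rewrite -Hardy_linear//; try exact: Lp_fun_measurable; try exact: Lp_fun_lty.
apply: Hardy_ae_eq => //.
- exact: Lp_fun_measurable.
- apply: scalar_measurableD; last exact: Lp_fun_measurable.
  by apply: scalar_measurableM; [exact: scalar_measurable_cst|exact: Lp_fun_measurable].
- exact: Lp_funP.
Qed.

Lemma Lp_unit_ballP (f : Lp s p v) : Lp_unit_ball p v f -> (J I (Lp_fun f) <= 1)%E.
Proof.
rewrite /Lp_unit_ball/= Lp_normE => f1.
have fin : J I (Lp_fun f) \is a fin_num by rewrite ge0_fin_numE ?pint_ge0// Lp_fun_lty.
move: f1; rewrite -(fineK fin) poweR_EFin !lee_fin => f1.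
rewrite -(powRVK (lt0r_neq0 p0) (fine_ge0 (pint_ge0 _ _ _ _))).
apply: (@le_trans _ _ (1 `^ p%:num)); last by rewrite powR1.
by rewrite ge0_ler_powR ?nnegrE ?powR_ge0.
Qed.

(** The factor is the p-th root of 1 / (1 + integral of |f|^p v); the summand 1 keeps it defined and
    nonzero for f = 0. *)
Lemma Lp_scale_unit_ball (f : Lp s p v) : exists2 c : K, c != 0 & Lp_unit_ball p v (c *: f).
Proof.
pose A := fine (J I (Lp_fun f)) + 1.
have fin : J I (Lp_fun f) \is a fin_num by rewrite ge0_fin_numE ?pint_ge0// Lp_fun_lty.
have A0 : 0 < A by rewrite ltr_wpDl// fine_ge0// pint_ge0.
pose l := (A^-1) `^ (p%:num)^-1; have l0 : 0 < l by rewrite powR_gt0// invr_gt0.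
have ml : modulus (mk_scalar s l 0) = l by rewrite modulus_real ger0_norm// ltW.
exists (mk_scalar s l 0).
  by apply/eqP => c0; move: ml; rewrite c0 modulus0 => /eqP; rewrite lt_eqF.
rewrite /Lp_unit_ball/= Lp_normE.
have -> : J I (Lp_fun (mk_scalar s l 0 *: f)) = ((l `^ p%:num)%:E * J I (Lp_fun f))%E.
  rewrite -[in RHS]ml -pintZ//; last exact: Lp_fun_measurable.
  apply: ae_eq_pint => //; try exact: Lp_fun_measurable.
    by apply: scalar_measurableM; [exact: scalar_measurable_cst|exact: Lp_fun_measurable].
  exact: Lp_funZ.
rewrite -(fineK fin) -EFinM poweR_EFin lee_fin.
rewrite powRVK ?invr_ge0 ?(ltW A0)//.
apply: (@le_trans _ _ (1 `^ (p%:num)^-1)); last by rewrite powR1.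
rewrite ge0_ler_powR ?nnegrE ?invr_ge0//.
  by rewrite mulr_ge0 ?invr_ge0 ?(ltW A0)// fine_ge0// pint_ge0.
by rewrite mulrC ler_pdivrMr// mul1r lerDl.
Qed.

End Hardy_theory.

(** * Closures of equicontinuous families *)

Lemma modulus_dist (R : realType) (s : scalars) (y z : Defs.scalar R s) :
  `|modulus y - modulus z| <= modulus (y - z).
Proof.
have H (x t : Defs.scalar R s) : modulus x - modulus t <= modulus (x - t).
  by rewrite lerBlDr -[in leLHS](subrK t x) modulusD.
have := H z y; rewrite -(opprB y z) modulusN => Hzy.
by rewrite ler_norml H andbT; lra.
Qed.

(** For real scalars [mk_scalar] discards its second argument; the factor 0 or 1 lets one formula
    serve both scalar fields. *)
Lemma im_mk_scalar (R : realType) (s : scalars) (x y : R) :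
  im_part (mk_scalar s x y) = (if s is ComplexScalars then 1 else 0) * y.
Proof. by case: s; rewrite /= ?mul0r ?mul1r. Qed.

(* A pair of scalar functions on I, encoded by its four real coordinates; the
   first boolean selects the function, the second one its real part. *)
Definition coords (R : realType) := {ptws (bool * bool * R)%type -> R}.

#[local] Instance coords_filter (R : realType) (phi : coords R) : ProperFilter (nbhs phi).
Proof. exact: nbhs_pfilter. Qed.

(** The value 0 outside I keeps every coordinate bounded, as Tychonoff's theorem needs a compact
    segment for each index. *)
Definition encode (R : realType) (s : scalars) (I : set R)
    (h k : R -> Defs.scalar R s) : coords R :=
  fun i => if i.2 \in I then part i.1.2 ((if i.1.1 then h else k) i.2) else 0.

Definition coord_prod (R : realType) (s : scalars) (phi : coords R) (x : R) :
    Defs.scalar R s :=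
  mk_scalar s (phi (true, true, x)) (phi (true, false, x)) *
  mk_scalar s (phi (false, true, x)) (phi (false, false, x)).

Lemma coord_prod_encode (R : realType) (s : scalars) (I : set R)
    (h k : R -> Defs.scalar R s) x : I x ->
  coord_prod s (encode I h k) x = h x * k x.
Proof. by move=> Ix; rewrite /coord_prod /encode/= mem_set// !mk_scalarK. Qed.

Section Coords.
Variables (R : realType) (s : scalars) (a b : \bar R) (S : set (coords R)).
Local Notation I := (oitv a b).
Local Notation Phi := (closure S).
Hypothesis ab : (a < b)%E.
Hypothesis S_bounded : forall i, exists M : R, forall phi, S phi -> `|phi i| <= M.
Hypothesis S_equicontinuous : forall x, I x -> forall e : R, 0 < e ->
  \forall y \near x, forall phi i j, S phi -> `|phi (i, j, y) - phi (i, j, x)| <= e.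

Lemma near_coord (phi : coords R) i (e : R) : 0 < e ->
  \forall psi \near phi, `|phi i - psi i| < e.
Proof.
move=> e0; have /(_ _ (nbhsx_ballx (phi i) e e0)) :=
  @proj_continuous (bool * bool * R)%type (fun=> R : topologicalType) i phi.
exact.
Qed.

Lemma compact_closure_coords : compact Phi.
Proof.
have [M MS] := choice S_bounded.
pose B := [set phi : coords R | forall i, `[- M i, M i]%classic (phi i)].
have cB : compact B.
  by apply: (@tychonoff _ (fun _ : bool * bool * R => R : topologicalType) (fun i => `[- M i, M i]%classic))
    => i; exact: segment_compact.
have clB : closed B.
  by apply: compact_closed cB; apply: hausdorff_product => _; exact: Rhausdorff.
apply: subclosed_compact cB _; first exact: closed_closure.
rewrite [B](closure_id B).1//; apply: closure_subset => phi Sphi i /=.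
by rewrite in_itv/= -ler_norml MS.
Qed.

(** The condition involves two coordinates at a time, and an element of [S] approximates phi at
    both; hence the same neighbourhood and the same [e] work for the closure. *)
Lemma closure_equicontinuous x (e : R) : I x -> 0 < e ->
  \forall y \near x, forall phi i j, Phi phi -> `|phi (i, j, y) - phi (i, j, x)| <= e.
Proof.
move=> Ix e0; have := S_equicontinuous Ix e0; apply: filterS => y Sy phi i j Pphi.
apply/ler_addgt0Pr => d d0; have d20 : 0 < d / 2 by rewrite divr_gt0.
have n1 := near_coord phi (i, j, y) d20.
have n2 := near_coord phi (i, j, x) d20.
have [psi [Spsi [psiy psix]]] := Pphi _ (filterI n1 n2).
have := Sy psi i j Spsi; move: psiy psix => /=.
move: (phi (i, j, y)) (phi (i, j, x)) (psi (i, j, y)) (psi (i, j, x)) => t u t' u' h1 h2 h3.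
rewrite (_ : t - u = (t - t') + (t' - u') - (u - u')); last by ring.
rewrite (le_trans (ler_normB _ _))//; move: (ler_normD (t - t') (t' - u')); lra.
Qed.

(** On an equicontinuous family, evaluation is jointly continuous in the point and the function;
    compactness of [c, d] then turns closeness near each point into uniform closeness. *)
Lemma near_coord_prod phi0 c d (e : R) : Phi phi0 -> I c -> I d -> 0 < e ->
  \forall phi \near phi0, Phi phi ->
    forall x, `[c, d]%classic x -> modulus (coord_prod s phi0 x - coord_prod s phi x) < e.
Proof.
move=> P0 Ic Id e0.
suff : \forall phi \near within Phi (nbhs phi0), `[c, d]%classic `<=`
    [set x | modulus (coord_prod s phi0 x - coord_prod s phi x) < e] by [].
have /compact_near_coveringP := @segment_compact _ c d.
apply => x /(itv_sub_oitv Ic Id) Ix.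
set F := within Phi (nbhs phi0).
have FF : Filter F by exact: within_filter.
have PF : \forall phi \near F, Phi phi by exact: withinT.
(* The increment splits into a change of function at the fixed point x, small by pointwise
   convergence, and a change of point for one function, small by equicontinuity. *)
have C1 i j : (fun z : R * coords R => z.2 (i, j, z.1)) @ filter_prod (nbhs x) F -->
    phi0 (i, j, x).
  apply/cvgrPdist_lt => r r0; have r20 : 0 < r / 2 by rewrite divr_gt0.
  near=> y phi => /=.
  have h1 : `|phi0 (i, j, x) - phi (i, j, x)| < r / 2.
    by near: phi; apply: cvg_within; exact: near_coord.
  have h2 : `|phi (i, j, y) - phi (i, j, x)| <= r / 2.
    have Pphi : Phi phi by near: phi.
    suff : forall phi i j, Phi phi -> `|phi (i, j, y) - phi (i, j, x)| <= r / 2 by exact.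
    by near: y; exact: closure_equicontinuous.
  rewrite (_ : _ - _ = (phi0 (i, j, x) - phi (i, j, x)) - (phi (i, j, y) - phi (i, j, x))).
    by rewrite (le_lt_trans (ler_normB _ _))//; move: h1 h2; lra.
  by ring.
have C2 i j : (fun z : R * coords R => phi0 (i, j, z.1)) @ filter_prod (nbhs x) F -->
    phi0 (i, j, x).
  apply/cvgrPdist_le => r r0.
  near=> y phi => /=; rewrite distrC.
  suff : forall phi i j, Phi phi -> `|phi (i, j, y) - phi (i, j, x)| <= r by exact.
  by near: y; exact: closure_equicontinuous.
have e20 : 0 < e / 2 by rewrite divr_gt0.
pose sg : R := if s is ComplexScalars then 1 else 0.
pose dre (z : R * coords R) := re_part (coord_prod s phi0 z.1 - coord_prod s z.2 z.1).
pose dim (z : R * coords R) := im_part (coord_prod s phi0 z.1 - coord_prod s z.2 z.1).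
have dre0 : dre @ filter_prod (nbhs x) F --> (0 : R).
  have -> : dre = fun z => (phi0 (true, true, z.1) * phi0 (false, true, z.1)
      - (sg * phi0 (true, false, z.1)) * (sg * phi0 (false, false, z.1)))
    - (z.2 (true, true, z.1) * z.2 (false, true, z.1)
      - (sg * z.2 (true, false, z.1)) * (sg * z.2 (false, false, z.1))).
    apply/funext => z; rewrite /dre re_partD re_partN !re_partM.
    by rewrite !re_mk_scalar !im_mk_scalar.
  rewrite -[X in _ --> X](subrr (phi0 (true, true, x) * phi0 (false, true, x)
      - (sg * phi0 (true, false, x)) * (sg * phi0 (false, false, x)))).
  apply: cvgB; apply: cvgB; apply: cvgM; try exact: C1; try exact: C2;
    by apply: cvgM; [exact: cvg_cst|first [exact: C1|exact: C2]].
have dim0 : dim @ filter_prod (nbhs x) F --> (0 : R).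
  have -> : dim = fun z => (phi0 (true, true, z.1) * (sg * phi0 (false, false, z.1))
      + (sg * phi0 (true, false, z.1)) * phi0 (false, true, z.1))
    - (z.2 (true, true, z.1) * (sg * z.2 (false, false, z.1))
      + (sg * z.2 (true, false, z.1)) * z.2 (false, true, z.1)).
    apply/funext => z; rewrite /dim im_partD im_partN !im_partM.
    by rewrite !re_mk_scalar !im_mk_scalar.
  rewrite -[X in _ --> X](subrr (phi0 (true, true, x) * (sg * phi0 (false, false, x))
      + (sg * phi0 (true, false, x)) * phi0 (false, true, x))).
  apply: cvgB; apply: cvgD; apply: cvgM; try exact: C1; try exact: C2;
    by apply: cvgM; [exact: cvg_cst|first [exact: C1|exact: C2]].
have : \forall z \near filter_prod (nbhs x) F, `|dre z| < e / 2 /\ `|dim z| < e / 2.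
  apply: filterI.
    by move/cvgrPdist_lt : dre0 => /(_ _ e20); apply: filterS => z; rewrite sub0r normrN.
  by move/cvgrPdist_lt : dim0 => /(_ _ e20); apply: filterS => z; rewrite sub0r normrN.
apply: filterS => -[y phi] /= [h1 h2].
apply: le_lt_trans (modulus_le_parts _) _.
by rewrite [e]splitr ltrD.
Unshelve. all: by end_near. Qed.

Lemma coord_measurable phi i j : Phi phi -> measurable_fun I (fun x => phi (i, j, x)).
Proof.
move=> Pphi; apply: open_continuous_measurable_fun; first exact: open_oitv.
move=> x /set_mem Ix; apply/cvgrPdist_le => e e0.
have := closure_equicontinuous Ix e0; apply: filterS => y /(_ phi i j Pphi).
by rewrite distrC.
Qed.

Lemma coord_prod_measurable phi : Phi phi -> scalar_measurable_fun I (coord_prod s phi).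
Proof.
move=> Pphi; apply: scalar_measurableM; split.
- by under eq_fun do rewrite re_mk_scalar; exact: coord_measurable.
- under eq_fun do rewrite im_mk_scalar.
  by apply: measurable_funM => //; exact: coord_measurable.
- by under eq_fun do rewrite re_mk_scalar; exact: coord_measurable.
- under eq_fun do rewrite im_mk_scalar.
  by apply: measurable_funM => //; exact: coord_measurable.
Qed.

(** Fatou's lemma needs a sequence, while phi is only a limit point for pointwise convergence.
    Elements [psi n] of [S] within 1/(n+1) of phi on [[c n, d n]], in the sense of the products,
    converge to it at every point of I. *)
Lemma closure_pint_le (q : R) (w : R -> \bar R) (E : set R) (M : \bar R) phi :
  0 < q -> measurable_fun I w ->
  {ae @lebesgue_measure R, forall x, I x -> w x \is a fin_num} ->
  measurable E -> (forall psi, S psi -> (pint q w (I `&` E) (coord_prod s psi) <= M)%E) ->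
  Phi phi -> (pint q w (I `&` E) (coord_prod s phi) <= M)%E.
Proof.
move=> q0 mw wfin mE SM Pphi; have mI := measurable_oitv a b.
have [c [d [cI dI cd cov]]] := oitv_exhaustion ab.
have approx n : exists psi, S psi /\ forall x, `[c n, d n]%classic x ->
    modulus (coord_prod s phi x - coord_prod s psi x) < n.+1%:R^-1.
  have n0 : 0 < n.+1%:R^-1 :> R by rewrite invr_gt0.
  have [psi [Spsi H]] := Pphi _ (near_coord_prod Pphi (cI n) (dI n) n0).
  by exists psi; split => //; apply: H; exact: subset_closure.
have [psi psiP] := choice approx.
have mIE : measurable (I `&` E) by exact: measurableI.
have IE : I `&` E `<=` I by move=> x [].
apply: (@pint_fatou _ _ _ _ _ (fun n => coord_prod s (psi n))) => //.
- exact: measurable_funS mw.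
- by apply: (@filterS _ _ (ae_filter_ringOfSetsType _) _ _ _ wfin) => x + [Ix _]; apply.
- move=> n; apply: scalar_measurableS IE _ => //; apply: coord_prod_measurable.
  by apply: subset_closure; exact: (psiP n).1.
- by apply: scalar_measurableS IE _ => //; exact: coord_prod_measurable.
- move=> x [Ix _]; apply/cvgrPdist_lt => e e0; near=> n.
  apply: le_lt_trans (modulus_dist _ _) _.
  apply: (@lt_trans _ _ n.+1%:R^-1); first by apply: (psiP n).2; near: n; exact: cov.
  by near: n; exact: near_infty_natSinv_lt (PosNum e0).
- by move=> n; apply: SM; exact: (psiP n).1.
Unshelve. all: by end_near. Qed.

End Coords.

(** * Compactness of the cut-off operator *)

Definition cutoff (R : realType) (s : scalars) (D : set R) (h : R -> Defs.scalar R s)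
    (x : R) : Defs.scalar R s := h x *+ (x \in D).

Lemma cutoff_measurable (R : realType) (s : scalars) (A D : set R)
    (h : R -> Defs.scalar R s) : measurable A -> measurable D ->
  scalar_measurable_fun A h -> scalar_measurable_fun A (cutoff D h).
Proof.
move=> mA mD mh.
have -> : cutoff D h = fun x => h x * mk_scalar s (\1_D x) 0.
  apply/funext => x; rewrite /cutoff indicE; case: (x \in D) => /=.
    by rewrite mulr1n (_ : mk_scalar s 1 0 = 1) ?mulr1//; case: (s).
  by rewrite mulr0n (_ : mk_scalar s 0 0 = 0) ?mulr0//; case: (s).
apply: scalar_measurableM => //; split.
  under eq_fun do rewrite re_mk_scalar.
  by apply: measurable_funTS; exact: measurable_indic.
by under eq_fun do rewrite im_mk_scalar mulr0; exact: measurable_cst.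
Qed.

Lemma pint_cutoff (R : realType) (s : scalars) (p : R) (w : R -> \bar R) (A D : set R)
    (h : R -> Defs.scalar R s) : 0 < p -> pint p w A (cutoff D h) = pint p w (A `&` D) h.
Proof.
move=> p0; rewrite !pintE integral_mkcondr; apply: eq_integral => x _.
rewrite patchE /cutoff; case: ifP => _; first by rewrite mulr1n.
by rewrite mulr0n modulus0 powR0 ?gt_eqF// mul0e.
Qed.

Section Cutoff_operator.
Local Open Scope quotient_scope.
Variables (R : realType) (s : scalars) (a b : \bar R) (p1 p2 q : {posnum R}) (p1' p2' : R).
Variables (v1 v2 u : weight a b).
Local Notation mu := (@lebesgue_measure R).
Local Notation I := (oitv a b).
Local Notation K := (Defs.scalar R s).
Local Notation X1 := (Lp s p1 v1).
Local Notation X2 := (Lp s p2 v2).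
Local Notation Y := (Lp s q u).
Local Notation J := (@pint R s q%:num u).
Local Notation B1 := (@Lp_unit_ball R s a b p1 v1).
Local Notation B2 := (@Lp_unit_ball R s a b p2 v2).
Local Notation H2 := (@Hardy2 R s a b p1 p2 v1 v2).
Hypothesis ab : (a < b)%E.
Hypothesis p1_gt1 : 1 < p1%:num.
Hypothesis p2_gt1 : 1 < p2%:num.
Hypothesis pp1 : (p1%:num)^-1 + p1'^-1 = 1.
Hypothesis pp2 : (p2%:num)^-1 + p2'^-1 = 1.
Hypothesis v1_pos : {ae mu, forall x, I x -> (0 < v1 x < +oo)%E}.
Hypothesis v2_pos : {ae mu, forall x, I x -> (0 < v2 x < +oo)%E}.
Hypothesis u_loc : locally_integrable_weight a b u.
Hypothesis V1_fin : forall x, I x ->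
  (\int[mu]_(t in oitv a x%:E) poweR (v1 t) (1 - p1') < +oo)%E.
Hypothesis V2_fin : forall x, I x ->
  (\int[mu]_(t in oitv a x%:E) poweR (v2 t) (1 - p2') < +oo)%E.

Let q0 : 0 < q%:num. Proof. by []. Qed.
Let mI : measurable I. Proof. exact: measurable_oitv. Qed.
Let m_u : measurable_fun I u. Proof. exact: (weightP u).1. Qed.
Let mS (E : set R) (h : R -> K) :
  scalar_measurable_fun I h -> scalar_measurable_fun (I `&` E) h.
Proof. by move=> mh; apply: scalar_measurableS mh => // x []. Qed.
Let muS (E : set R) : measurable_fun (I `&` E) u.
Proof. by apply: measurable_funS m_u => // x []. Qed.

Lemma Hardy2_measurable f g : scalar_measurable_fun I (H2 f g).
Proof.
apply: scalar_measurableM.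
  exact: (Hardy_measurable p1_gt1 pp1 v1_pos V1_fin (Lp_fun_measurable _) (Lp_fun_lty _)).
exact: (Hardy_measurable p2_gt1 pp2 v2_pos V2_fin (Lp_fun_measurable _) (Lp_fun_lty _)).
Qed.

Lemma Hardy2_linearl (c : K) (f f' : X1) (g : X2) x : I x ->
  H2 (c *: f + f') g x = c * H2 f g x + H2 f' g x.
Proof.
move=> Ix; rewrite /Hardy2 (Hardy_Lp_linear p1_gt1 pp1 v1_pos V1_fin)//.
by rewrite mulrDl mulrA.
Qed.

Lemma Hardy2_linearr (c : K) (f : X1) (g g' : X2) x : I x ->
  H2 f (c *: g + g') x = c * H2 f g x + H2 f g' x.
Proof.
move=> Ix; rewrite /Hardy2 (Hardy_Lp_linear p2_gt1 pp2 v2_pos V2_fin)//.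
by rewrite mulrDr mulrCA.
Qed.

Lemma Hardy2_scale (c d : K) (f : X1) (g : X2) x : I x ->
  H2 (c *: f) (d *: g) x = c * d * H2 f g x.
Proof.
move=> Ix; have E1 : H2 (c *: f) (d *: g) x = c * H2 f (d *: g) x.
  have := Hardy2_linearl c f 0 (d *: g) Ix; rewrite addr0 => ->.
  (* Linearity at (-1) 0 + 0 shows that the value at 0 is 0. *)
  have := Hardy2_linearl (-1) 0 0 (d *: g) Ix.
  by rewrite scaleN1r oppr0 addr0 mulN1r addNr => ->; rewrite addr0.
have E2 : H2 f (d *: g) x = d * H2 f g x.
  have := Hardy2_linearr d f g 0 Ix; rewrite addr0 => ->.
  have := Hardy2_linearr (-1) f 0 0 Ix.
  by rewrite scaleN1r oppr0 addr0 mulN1r addNr => ->; rewrite addr0.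
by rewrite E1 E2 mulrA.
Qed.

Definition Hardy_coords : set (coords R) :=
  [set encode I (Hardy a (Lp_fun f)) (Hardy a (Lp_fun g)) | f in B1 & g in B2].

Local Notation S := Hardy_coords.

Lemma Hardy_coords_bounded i : exists M : R, forall phi, S phi -> `|phi i| <= M.
Proof.
case: i => [[i j] x]; have [Ix|nIx] := pselect (I x); last first.
  by exists 0 => _ [f _ [g _ <-]]; rewrite /encode/= memNset// normr0.
case: i.
  have [M HM] := Hardy_bounded s p1_gt1 pp1 v1_pos V1_fin Ix.
  exists M => _ [f B1f [g _ <-]]; rewrite /encode/= mem_set//; apply: HM.
    exact: Lp_fun_measurable.
  exact: Lp_unit_ballP.
have [M HM] := Hardy_bounded s p2_gt1 pp2 v2_pos V2_fin Ix.
exists M => _ [f _ [g B2g <-]]; rewrite /encode/= mem_set//; apply: HM.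
  exact: Lp_fun_measurable.
exact: Lp_unit_ballP.
Qed.

Lemma Hardy_coords_equicontinuous x : I x -> forall e : R, 0 < e ->
  \forall y \near x, forall phi i j, S phi -> `|phi (i, j, y) - phi (i, j, x)| <= e.
Proof.
move=> Ix e e0.
have E1 := Hardy_equicontinuous s p1_gt1 pp1 v1_pos V1_fin Ix ltr01 e0.
have E2 := Hardy_equicontinuous s p2_gt1 pp2 v2_pos V2_fin Ix ltr01 e0.
have nI : \forall y \near x, I y.
  by apply: open_nbhs_nbhs; split => //; exact: open_oitv.
apply: filterS3 E1 E2 nI => y E1y E2y Iy phi i j [f B1f [g B2g <-]].
rewrite /encode/= !mem_set//; case: i.
  by apply: E1y; [exact: Lp_fun_measurable|exact: Lp_unit_ballP].
by apply: E2y; [exact: Lp_fun_measurable|exact: Lp_unit_ballP].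
Qed.

Lemma pint_encode (E : set R) f g :
  J (I `&` E) (coord_prod s (encode I (Hardy a (Lp_fun f)) (Hardy a (Lp_fun g)))) =
  J (I `&` E) (H2 f g).
Proof. by apply: eq_pint => x [Ix _]; rewrite coord_prod_encode. Qed.

Variable D : set R.
Hypothesis mD : measurable D.
Hypothesis D_bounded : exists M : R, forall f g, B1 f -> B2 g ->
  (J (I `&` D) (H2 f g) <= M%:E)%E.
Hypothesis D_tight : forall e : R, 0 < e -> exists c d, [/\ I c, I d &
  forall f g, B1 f -> B2 g -> (J (I `&` (D `\` `[c, d])) (H2 f g) <= e%:E)%E].

(** The bound is assumed on the unit balls only, but the operator must be defined everywhere: f and
    g are scaled into the balls and the bound is scaled back by homogeneity. *)
Lemma cutoff_Hardy2_Lfunctions f g : cutoff D (H2 f g) \in Lfunctions q u.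
Proof.
apply/LfunctionsP; split; first by apply: cutoff_measurable => //; exact: Hardy2_measurable.
rewrite pint_cutoff//.
have [c c0 Bc] := Lp_scale_unit_ball f; have [d d0 Bd] := Lp_scale_unit_ball g.
have [M /(_ _ _ Bc Bd)] := D_bounded.
have -> : J (I `&` D) (H2 (c *: f) (d *: g)) =
    J (I `&` D) (fun x => c * d * H2 f g x).
  by apply: eq_pint => x [Ix _]; exact: Hardy2_scale.
rewrite pintZ//; [|exact: measurableI|by apply: mS; exact: Hardy2_measurable].
have m0 : 0 < modulus (c * d) `^ q%:num.
  rewrite powR_gt0// lt_neqAle modulus_ge0 andbT eq_sym; apply/eqP => /modulus_eq0/eqP.
  by rewrite mulf_eq0 (negbTE c0) (negbTE d0).
rewrite muleC -lee_pdivlMr// => /le_lt_trans; apply.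
by rewrite -EFinM ltry.
Qed.

Definition cutoff_Hardy2 (f : X1) (g : X2) : Y :=
  \pi_Y (@exist (R -> K^o) (fun h => h \in Lfunctions q u) _
    (cutoff_Hardy2_Lfunctions f g) : Defs.Lfun s q u).

Lemma cutoff_Hardy2E f g : ae_eq_weight u (Lp_fun (cutoff_Hardy2 f g)) (cutoff D (H2 f g)).
Proof. exact: Lp_fun_pi. Qed.

Lemma cutoff_Hardy2_bilinear :
  bilinear_for *:%R *:%R cutoff_Hardy2.
Proof.
split=> [g c f f'|f c g g']; apply: Lp_eq.
  have A1 := cutoff_Hardy2E (c *: f + f') g.
  have A2 := cutoff_Hardy2E f g.
  have A3 := cutoff_Hardy2E f' g.
  have A4 := Lp_funP c (cutoff_Hardy2 f g) (cutoff_Hardy2 f' g).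
  apply: (@filterS2 _ _ (ae_filter_ringOfSetsType _) _ _ _ _ 
    (@filterI _ _ (ae_filter_ringOfSetsType mu) _ _ A1 A2)
    (@filterI _ _ (ae_filter_ringOfSetsType mu) _ _ A3 A4)).
  move=> x [B1x B2x] [B3x B4x] Ix ux.
  rewrite B1x// B4x// B2x// B3x// /cutoff Hardy2_linearl//.
  by rewrite mulrnDl mulrnAr.
have A1 := cutoff_Hardy2E f (c *: g + g').
have A2 := cutoff_Hardy2E f g.
have A3 := cutoff_Hardy2E f g'.
have A4 := Lp_funP c (cutoff_Hardy2 f g) (cutoff_Hardy2 f g').
apply: (@filterS2 _ _ (ae_filter_ringOfSetsType _) _ _ _ _ 
    (@filterI _ _ (ae_filter_ringOfSetsType mu) _ _ A1 A2)
    (@filterI _ _ (ae_filter_ringOfSetsType mu) _ _ A3 A4)).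
move=> x [B1x B2x] [B3x B4x] Ix ux.
rewrite B1x// B4x// B2x// B3x// /cutoff Hardy2_linearr//.
by rewrite mulrnDl mulrnAr.
Qed.

HB.instance Definition _ :=
  bilinear_isBilinear.Build K X1 X2 Y *:%R *:%R cutoff_Hardy2 cutoff_Hardy2_bilinear.

(** Membership in L^q(u) is proved only on the closure of the Hardy pairs; elsewhere [insubd]
    returns the default 0. *)
Definition coord_class (phi : coords R) : Y :=
  \pi_Y (insubd (0 : Defs.Lfun s q u) (cutoff D (coord_prod s phi))).

Lemma closure_cutoff_Lfunctions phi : closure S phi ->
  cutoff D (coord_prod s phi) \in Lfunctions q u.
Proof.
move=> Pphi; have mphi : scalar_measurable_fun I (coord_prod s phi).
  exact: (coord_prod_measurable _ Hardy_coords_equicontinuous).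
apply/LfunctionsP; split; first exact: cutoff_measurable.
rewrite pint_cutoff//; have [M DM] := D_bounded.
apply: (@le_lt_trans _ _ M%:E); last exact: ltry.
apply: (closure_pint_le ab Hardy_coords_equicontinuous q0 m_u _ mD _ Pphi).
  exact: locally_integrable_fin.
by move=> _ [f Bf [g Bg <-]]; rewrite pint_encode; exact: DM.
Qed.

Lemma coord_classE phi : closure S phi ->
  ae_eq_weight u (Lp_fun (coord_class phi)) (cutoff D (coord_prod s phi)).
Proof.
move=> Pphi; have := Lp_fun_pi (insubd (0 : Defs.Lfun s q u) (cutoff D (coord_prod s phi))).
by rewrite insubdK//; exact: closure_cutoff_Lfunctions.
Qed.

(** On D inside [c, d], uniform closeness meets the integrability of u; outside [c, d], both
    functions have small integrals, without any use of their closeness. *)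
Lemma coord_class_continuous : {within closure S, continuous coord_class}.
Proof.
apply/subspace_continuousP => phi0 P0 U /Lp_nbhsP[e e0 eU].
have r0 := gauge_exp_gt0 q0; set r := gauge_exp _ in eU r0.
(* [E] is the size of the integral that corresponds to distance [e]. Near and far parts get E / 4
   each, so the sum stays strictly below [E]. In [t], the factor 2^q comes from [pintD_le] and the 2
   from the two tails added. *)
pose E := e `^ r^-1; have E0 : 0 < E by rewrite powR_gt0.
pose t := E / 4 / 2 `^ q%:num / 2.
have t0 : 0 < t by rewrite !divr_gt0 ?powR_gt0.
have [c [d [Ic Id tight]]] := D_tight t0.
have mcd : measurable `[c, d]%classic by exact: measurable_itv.
have mDcd : measurable (D `\` `[c, d]) by apply: measurableD => //; exact: measurable_itv.
have mDIcd : measurable (D `&` `[c, d]) by apply: measurableI => //; exact: measurable_itv.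
have uint : mu.-integrable `[c, d] u.
  by apply: u_loc; [exact: itv_sub_oitv|exact: segment_compact].
pose N := fine (\int[mu]_(x in `[c, d]) `|u x|).
have N0 : 0 <= N by rewrite fine_ge0// integral_ge0.
have NE : (\int[mu]_(x in `[c, d]) `|u x| = N%:E)%E.
  rewrite fineK// ge0_fin_numE ?integral_ge0//.
  by case/integrableP : uint.
(* Chosen so that eta^q times the mass [N] of u on [c, d] is at most E / 4; [N + 1] avoids a
   division by 0. *)
pose eta := (E / 4 / (N + 1)) `^ (q%:num)^-1.
have N10 : 0 < N + 1 by rewrite ltr_wpDl.
have eta0 : 0 < eta by rewrite powR_gt0// !divr_gt0.
have := near_coord_prod s Hardy_coords_equicontinuous P0 Ic Id eta0.
apply: filterS => phi + Pphi => /(_ Pphi) close; apply: eU.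
have mP psi : closure S psi -> scalar_measurable_fun I (coord_prod s psi).
  exact: (coord_prod_measurable _ Hardy_coords_equicontinuous).
pose dl x := coord_prod s phi0 x - coord_prod s phi x.
have mdl : scalar_measurable_fun I dl by apply: scalar_measurableB; exact: mP.
have -> : J I (fun x => Lp_fun (coord_class phi0) x - Lp_fun (coord_class phi) x) =
    J (I `&` D) dl.
  rewrite -pint_cutoff//; apply: ae_eq_pint => //.
  - by apply: scalar_measurableB; exact: Lp_fun_measurable.
  - exact: cutoff_measurable.
  apply: (@filterS2 _ _ (ae_filter_ringOfSetsType _) _ _ _ _
    (coord_classE P0) (coord_classE Pphi)) => x h0 h Ix ux.
  apply: (etrans (congr2 (fun y z => y - z) (h0 Ix ux) (h Ix ux))).
  by rewrite /cutoff -mulrnBl.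
have m1 : measurable (I `&` (D `&` `[c, d])) by exact: measurableI.
have m2 : measurable (I `&` (D `\` `[c, d])) by exact: measurableI.
have IDE : (I `&` (D `&` `[c, d])) `|` (I `&` (D `\` `[c, d])) = I `&` D.
  by rewrite -setIUr setUIDK.
have disj : (I `&` (D `&` `[c, d])) `&` (I `&` (D `\` `[c, d])) = set0.
  by apply/seteqP; split => // x [[_ [_ cdx]] [_ [_ /(_ cdx)]]].
rewrite -IDE pint_setU//; [|by rewrite IDE|by rewrite IDE; exact: mS].
have near_part : (J (I `&` (D `&` `[c, d])) dl <= (E / 4)%:E)%E.
  apply: (@le_trans _ _ (J (I `&` (D `&` `[c, d])) (fun=> mk_scalar s eta 0))).
    apply: le_pint => //.
    - exact: mS.
    move=> x [_ [_ xcd]]; rewrite modulus_real ger0_norm ?(ltW eta0)//.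
    by apply: ltW; exact: close.
  apply: (@le_trans _ _ (J `[c, d] (fun=> mk_scalar s eta 0))).
    apply: subset_pint => //.
    - by case/integrableP : uint.
    - by move=> x [_ []].
  rewrite pintE modulus_real ger0_norm ?(ltW eta0)// ge0_integralZl//; last first.
  - by rewrite lee_fin powR_ge0.
  - by apply: measurableT_comp => //; case/integrableP : uint.
  rewrite NE powRVK ?gt_eqF ?divr_ge0 ?(ltW E0) ?(ltW N10)// -EFinM lee_fin.
  by rewrite mulrAC ler_pdivrMr// ler_wpM2l ?divr_ge0 ?(ltW E0)// lerDl.
have far_part : (J (I `&` (D `\` `[c, d])) dl <= (E / 4)%:E)%E.
  have tP psi : closure S psi -> (J (I `&` (D `\` `[c, d])) (coord_prod s psi) <= t%:E)%E.
    move=> Ppsi; apply: (closure_pint_le ab Hardy_coords_equicontinuous q0 m_u _ mDcd _ Ppsi).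
      exact: locally_integrable_fin.
    by move=> _ [f Bf [g Bg <-]]; rewrite pint_encode; exact: tight.
  have := @pintD_le _ s q%:num q0 u (I `&` (D `\` `[c, d])) (coord_prod s phi0)
    (fun x => - coord_prod s phi x) dl m2 (@muS _) (mS _ (mP _ P0))
    (scalar_measurableN (mS _ (mP _ Pphi))) (mS _ mdl) (fun _ _ => erefl _).
  move=> /le_trans; apply.
  have -> : J (I `&` (D `\` `[c, d])) (fun x => - coord_prod s phi x) =
      J (I `&` (D `\` `[c, d])) (coord_prod s phi).
    by rewrite !pintE; apply: eq_integral => x _; rewrite modulusN.
  apply: (@le_trans _ _ ((2 `^ q%:num)%:E * (t%:E + t%:E))%E).
    by rewrite lee_wpmul2l ?lee_fin ?powR_ge0// leeD ?tP.
  rewrite -EFinD -EFinM lee_fin le_eqVlt; apply/orP; left; apply/eqP.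
  by rewrite /t; field; rewrite gt_eqF ?powR_gt0.
have sumE : (J (I `&` (D `&` `[c, d])) dl + J (I `&` (D `\` `[c, d])) dl <= (E / 2)%:E)%E.
  rewrite (_ : E / 2 = E / 4 + E / 4); last by field.
  by rewrite EFinD leeD.
apply: (@le_lt_trans _ _ (poweR (E / 2)%:E r)).
  by apply: le_gauge; rewrite ?(ltW r0) ?adde_ge0 ?pint_ge0.
rewrite poweR_EFin lte_fin -[ltRHS](powRVK (lt0r_neq0 r0) (ltW e0)) -/E.
by rewrite gt0_ltr_powR ?nnegrE ?divr_ge0 ?(ltW E0)// ltr_pdivrMr// ltr_pMr// ltr1n.
Qed.

(** The image of the compact closure is closed because L^q(u) is Hausdorff, so it contains the
    closure of the operator's image of the unit balls. *)
Lemma cutoff_Hardy2_compact : compact_map cutoff_Hardy2.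
Proof.
have cS := compact_closure_coords Hardy_coords_bounded.
have cP : compact (coord_class @` closure S).
  exact: continuous_compact coord_class_continuous cS.
have clP : closed (coord_class @` closure S) by exact: compact_closed (@Lp_hausdorff _ _ _ _ _ _) cP.
apply: subclosed_compact cP _; first exact: closed_closure.
rewrite [X in _ `<=` X](closure_id _).1//; apply: closure_subset => _ [f Bf [g Bg <-]].
have Sfg : S (encode I (Hardy a (Lp_fun f)) (Hardy a (Lp_fun g))) by exists f => //; exists g.
exists (encode I (Hardy a (Lp_fun f)) (Hardy a (Lp_fun g))); first exact: subset_closure.
apply: Lp_eq; have h1 := coord_classE (subset_closure Sfg).
apply: (@filterS2 _ _ (ae_filter_ringOfSetsType _) _ _ _ _ h1 (cutoff_Hardy2E f g)).
by move=> x h1x h2x Ix ux; rewrite h1x// h2x// /cutoff coord_prod_encode.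
Qed.

Lemma cutoff_Hardy2_operator : exists T : {bilinear X1 -> X2 -> Y},
  compact_map T /\ forall f g, ae_eq_weight u (Lp_fun (T f g)) (cutoff D (H2 f g)).
Proof.
exists cutoff_Hardy2; split; [exact: cutoff_Hardy2_compact|exact: cutoff_Hardy2E].
Qed.

End Cutoff_operator.

(** * The essential norm *)

Lemma poweR_root_le (R : realType) (q t : R) (x : \bar R) : 0 < q -> 0 <= t -> (0 <= x)%E ->
  (poweR x q^-1 <= t%:E)%E <-> (x <= (t `^ q)%:E)%E.
Proof.
move=> q0 t0 x0; have qV0 : 0 <= q^-1 by rewrite invr_ge0 ltW.
split => [h|h].
  have := le_gauge (ltW q0) (poweR_ge0 _ _) h.
  by rewrite -poweRrM mulVf ?gt_eqF// poweRe1.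
apply: (le_trans (le_gauge qV0 x0 h)).
by rewrite poweR_EFin powRKV// gt_eqF.
Qed.

Lemma limf_esup_le_near (R : realType) (F : set_system R) (f : R -> \bar R) (t : \bar R) :
  (\forall c \near F, (f c <= t)%E) -> (limf_esup f F <= t)%E.
Proof.
move=> ft; rewrite limf_esupE; apply: (@le_trans _ _ (ereal_sup [set f x | x in [set c | (f c <= t)%E]])).
  by apply: ereal_inf_lbound => /=; exists [set c | (f c <= t)%E].
by apply: ge_ereal_sup => _ [c /= fct <-].
Qed.

Lemma limf_esup_lt_near (R : realType) (F : set_system R) (f : R -> \bar R) (t : \bar R) :
  Filter F -> (limf_esup f F < t)%E -> \forall c \near F, (f c < t)%E.
Proof.
move=> FF; rewrite limf_esupE => /ereal_inf_lt[_ [V FV <-] Vt].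
apply: filterS FV => c Vc; apply: le_lt_trans Vt.
by apply: ereal_sup_ubound; exists c.
Qed.

Lemma limf_esup_ge0_near (R : realType) (F : set_system R) (f : R -> \bar R) :
  ProperFilter F -> (\forall c \near F, (0 <= f c)%E) -> (0 <= limf_esup f F)%E.
Proof.
move=> PF f0; rewrite leNgt; apply/negP => /(limf_esup_lt_near _)/(filterI f0).
by move=> /filter_ex[c [/= c0]]; rewrite ltNge c0.
Qed.

Lemma cvge0_near (R : realType) (F : set_system R) (f : R -> \bar R) : Filter F ->
  (forall e : R, 0 < e -> \forall c \near F, (0 <= f c <= e%:E)%E) -> f @ F --> 0%E.
Proof.
move=> FF fe; apply/fine_cvgP; split.
  apply: filterS (fe 1 ltr01) => c /andP[f0 f1].
  by rewrite ge0_fin_numE// (le_lt_trans f1)// ltry.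
apply/cvgrPdist_le => e e0; apply: filterS (fe e e0) => c /andP[f0 f1] /=.
rewrite sub0r normrN ger0_norm ?fine_ge0// -lee_fin fineK//.
by rewrite ge0_fin_numE// (le_lt_trans f1)// ltry.
Qed.

Section Essential_norm.
Variables (R : realType) (s : scalars) (a b : \bar R) (p1 p2 q : {posnum R}) (p1' p2' : R).
Variables (v1 v2 u : weight a b).
Local Notation mu := (@lebesgue_measure R).
Local Notation I := (oitv a b).
Local Notation K := (Defs.scalar R s).
Local Notation X1 := (Lp s p1 v1).
Local Notation X2 := (Lp s p2 v2).
Local Notation Y := (Lp s q u).
Local Notation J := (@pint R s q%:num u).
Local Notation B1 := (@Lp_unit_ball R s a b p1 v1).
Local Notation B2 := (@Lp_unit_ball R s a b p2 v2).
Local Notation H2 := (@Hardy2 R s a b p1 p2 v1 v2).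
Hypothesis ab : (a < b)%E.
Hypothesis p1_gt1 : 1 < p1%:num.
Hypothesis p2_gt1 : 1 < p2%:num.
Hypothesis pp1 : (p1%:num)^-1 + p1'^-1 = 1.
Hypothesis pp2 : (p2%:num)^-1 + p2'^-1 = 1.
Hypothesis v1_pos : {ae mu, forall x, I x -> (0 < v1 x < +oo)%E}.
Hypothesis v2_pos : {ae mu, forall x, I x -> (0 < v2 x < +oo)%E}.
Hypothesis u_loc : locally_integrable_weight a b u.
Hypothesis V1_fin : forall x, I x ->
  (\int[mu]_(t in oitv a x%:E) poweR (v1 t) (1 - p1') < +oo)%E.
Hypothesis V2_fin : forall x, I x ->
  (\int[mu]_(t in oitv a x%:E) poweR (v2 t) (1 - p2') < +oo)%E.

Let q0 : 0 < q%:num. Proof. by []. Qed.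
Let mI : measurable I. Proof. exact: measurable_oitv. Qed.
Let m_u : measurable_fun I u. Proof. exact: (weightP u).1. Qed.
Let mS (E : set R) (h : R -> K) :
  scalar_measurable_fun I h -> scalar_measurable_fun (I `&` E) h.
Proof. by move=> mh; apply: scalar_measurableS mh => // x []. Qed.
Let muS (E : set R) : measurable_fun (I `&` E) u.
Proof. by apply: measurable_funS m_u => // x []. Qed.
Let mH2 f g : scalar_measurable_fun I (H2 f g).
Proof. exact: (Hardy2_measurable p1_gt1 p2_gt1 pp1 pp2). Qed.

Lemma opnorm_leP w (T : X1 -> X2 -> R -> K) (t : \bar R) : (opnorm q w T <= t)%E <->
  forall f g, B1 f -> B2 g -> (wnorm a b q%:num w (T f g) <= t)%E.
Proof.
split => [h f g Bf Bg|h].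
  by apply: le_trans h; apply: ereal_sup_ubound; exists f => //; exists g.
by apply: ge_ereal_sup => _ [f Bf [g Bg <-]]; exact: h.
Qed.

Lemma opnorm_restrict_leP (E : set R) (t : R) : measurable E -> 0 <= t ->
  (opnorm q (restrict_weight u E) H2 <= t%:E)%E <->
  forall f g, B1 f -> B2 g -> (J (I `&` E) (H2 f g) <= (t `^ q%:num)%:E)%E.
Proof.
move=> mE t0; rewrite opnorm_leP; split=> h f g Bf Bg; have := h f g Bf Bg.
  rewrite wnorm_restrictE//; last exact: weightP.
  by move/poweR_root_le; apply => //; exact: pint_ge0.
rewrite wnorm_restrictE//; last exact: weightP.
by move=> ?; apply/poweR_root_le => //; exact: pint_ge0.
Qed.

(** The supremum of an empty set would be -oo, so nonemptiness of both unit balls is what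
    matters. *)
Lemma opnorm_ge0 (w : R -> \bar R) (T : X1 -> X2 -> R -> K) : (0 <= opnorm q w T)%E.
Proof.
have [c _ Bc] := Lp_scale_unit_ball (0 : X1); have [d _ Bd] := Lp_scale_unit_ball (0 : X2).
apply: le_trans (ereal_sup_ubound _); last by exists (c *: 0) => //; exists (d *: 0).
exact: poweR_ge0.
Qed.

(** With m = min(1, q), the m-th power of the norm of H_2(f, g) over [E c] is at most that of the
    difference with T plus that of T(f, g) over [E c]. The second is uniformly small, and the strict
    inequality in the hypothesis leaves the gap [N^m - n0^m] for it. *)
Lemma opnorm_escaping (G : set_system R) (E : R -> set R) (T : {bilinear X1 -> X2 -> Y})
    (N : R) : Filter G -> (forall c, measurable (E c)) -> escaping a b G E ->
  compact_map T ->
  (opnorm q u (fun f g x => H2 f g x - Lp_fun (T f g) x)%R < N%:E)%E ->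
  \forall c \near G, (opnorm q (restrict_weight u (E c)) H2 <= N%:E)%E.
Proof.
move=> FG mE esc cT; set n0 := opnorm _ _ _ => n0N.
have n0_ge0 : (0 <= n0)%E by exact: opnorm_ge0.
have n0fin : n0 \is a fin_num by rewrite ge0_fin_numE// (lt_trans n0N)// ltry.
have n0E : n0 = (fine n0)%:E by rewrite fineK.
have fn0 : 0 <= fine n0 by rewrite fine_ge0.
move: n0N; rewrite n0E lte_fin => n0N.
have N0 : 0 < N by exact: le_lt_trans n0N.
pose m := Num.min 1 q%:num; have m0 : 0 < m by rewrite lt_min ltr01 q0.
have r0 := gauge_exp_gt0 q0; set r := gauge_exp q%:num in r0 *.
have d0 : 0 < N `^ m - fine n0 `^ m.
  by rewrite subr_gt0 gt0_ltr_powR ?nnegrE ?(ltW N0).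
have := compact_escaping ab FG mE esc cT d0; apply: filterS => c Ec.
apply/opnorm_restrict_leP => //; first exact: ltW.
move=> f g Bf Bg; have mIE : measurable (I `&` E c) by exact: measurableI.
have mT : scalar_measurable_fun I (Lp_fun (T f g)) by exact: Lp_fun_measurable.
have mD : scalar_measurable_fun I (fun x => H2 f g x - Lp_fun (T f g) x).
  exact: scalar_measurableB.
have H : (poweR (J (I `&` E c) (H2 f g)) r <= (N `^ m)%:E)%E.
  apply: (@le_trans _ _ (poweR (J (I `&` E c) (fun x => H2 f g x - Lp_fun (T f g) x)%R) r +
      poweR (J (I `&` E c) (Lp_fun (T f g))) r)%E).
    apply: gauge_triangle => //; try exact: mS.
    by move=> x _; rewrite subrK.
  rewrite -(subrKC (fine n0 `^ m) (N `^ m)) EFinD; apply: leeD; last first.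
    by apply: ltW; apply: Ec; apply: subset_closure; exists f => //; exists g.
  apply: (@le_trans _ _ (poweR (J I (fun x => H2 f g x - Lp_fun (T f g) x)%R) r)).
    by apply: le_gauge; rewrite ?(ltW r0) ?pint_ge0//; exact: subset_pint.
  rewrite -gaugeE -poweR_EFin; apply: le_gauge; rewrite ?(ltW m0) ?poweR_ge0//.
  rewrite -n0E -wnormE//; last exact: weightP.
  by move: f g Bf Bg {mT mD}; apply/opnorm_leP.
have Nr : N `^ m = (N `^ q%:num) `^ r.
  by rewrite -powRrM /r /gauge_exp mulrA mulfV ?mul1r.
have Jfin : J (I `&` E c) (H2 f g) \is a fin_num.
  rewrite ge0_fin_numE ?pint_ge0//; apply: (@lty_poweRy _ _ r); first by rewrite gt_eqF.
  by apply: le_lt_trans H _; rewrite ltry.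
move: H; rewrite -(fineK Jfin) poweR_EFin !lee_fin Nr.
rewrite !leNgt; apply: contra => H.
by rewrite gt0_ltr_powR ?nnegrE ?powR_ge0 ?fine_ge0 ?pint_ge0.
Qed.

(** The two end pieces are disjoint, so their integrals add without loss. *)
Lemma pint_outside c d (h : R -> K) : I c -> I d -> c <= d -> scalar_measurable_fun I h ->
  J (I `&` ~` `[c, d]) h = (J (I `&` oitv a c%:E) h + J (I `&` oitv d%:E b) h)%E.
Proof.
move=> /andP[ac cb] /andP[ad db] cd mh.
have E : I `&` ~` `[c, d] = (I `&` oitv a c%:E) `|` (I `&` oitv d%:E b).
  apply/seteqP; split=> [x [Ix /= ncd]|x [[Ix /andP[_ xc]]|[Ix /andP[dx _]]]].
  - have /andP[ax xb] := Ix; have [xc|cx] := ltP x c.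
      by left; split => //; rewrite /oitv/= ax lte_fin.
    right; split => //; rewrite /oitv/= xb andbT lte_fin ltNge.
    by apply/negP => xd; apply: ncd; rewrite in_itv/= cx.
  - by split => //=; rewrite in_itv/= leNgt -lte_fin xc.
  - by split => //=; rewrite in_itv/= [x <= d]leNgt -lte_fin dx andbF.
rewrite E pint_setU//.
- by apply: measurableI => //; exact: measurable_oitv.
- by apply: measurableI => //; exact: measurable_oitv.
- by rewrite -E.
- by rewrite -E; exact: mS.
apply/seteqP; split => // x [[_ /andP[_ xc]] [_ /andP[dx _]]].
by have := lt_trans dx xc; rewrite lte_fin ltNge cd.
Qed.

Lemma opnorm_whole : opnorm q u H2 = opnorm q (restrict_weight u setT) H2.
Proof.
suff -> : restrict_weight u setT = u by [].
by apply/funext => x; rewrite /restrict_weight indicT mule1.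
Qed.

Lemma compact_operator_bounded : compact_operator q u H2 -> (opnorm q u H2 < +oo)%E.
Proof.
move=> [T [TE cT]]; have [M MP] := compact_bounded cT.
(* [M] comes without a sign; the maximum with 0 makes its q-th root meaningful. *)
apply: (@le_lt_trans _ _ ((Num.max 0 M `^ (q%:num)^-1)%:E)); last exact: ltry.
rewrite opnorm_whole; apply/opnorm_restrict_leP => //; first exact: powR_ge0.
move=> f g Bf Bg; rewrite setIT powRVK ?gt_eqF ?le_max ?lexx//.
rewrite (_ : J I (H2 f g) = J I (Lp_fun (T f g))).
  apply: (@le_trans _ _ M%:E); last by rewrite lee_fin le_max lexx orbT.
  by apply: MP; apply: subset_closure; exists f => //; exists g.
apply/esym; apply: ae_eq_pint => //; [exact: Lp_fun_measurable|exact: TE].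
Qed.

(** Here H_2 is its own compact approximation: the difference has norm 0, so every N > 0 is
    admissible. *)
Lemma compact_operator_escaping (G : set_system R) (E : R -> set R) (N : R) :
  Filter G -> (forall c, measurable (E c)) -> escaping a b G E ->
  compact_operator q u H2 -> 0 < N ->
  \forall c \near G, (opnorm q (restrict_weight u (E c)) H2 <= N%:E)%E.
Proof.
move=> FG mE esc [T [TE cT]] N0; apply: opnorm_escaping esc cT _ => //.
apply: (@le_lt_trans _ _ 0%E); last by rewrite lte_fin.
apply/opnorm_leP => f g Bf Bg; rewrite wnormE; last 2 first.
- exact: weightP.
- by apply: scalar_measurableB => //; exact: Lp_fun_measurable.
rewrite (_ : J I _ = 0%E); first by rewrite poweR0r// gt_eqF ?invr_gt0.
rewrite (_ : J I _ = J I (fun=> 0)).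
  by rewrite pintE integral0_eq// => x _; rewrite modulus0 powR0 ?gt_eqF// mul0e.
apply: ae_eq_pint => //.
- by apply: scalar_measurableB => //; exact: Lp_fun_measurable.
apply: (@filterS _ _ (ae_filter_ringOfSetsType _) _ _ _ (TE f g)) => x TEx Ix ux.
by rewrite TEx// subrr.
Qed.

Lemma bounded_pint : (opnorm q u H2 < +oo)%E ->
  exists M : R, forall f g, B1 f -> B2 g -> (J I (H2 f g) <= M%:E)%E.
Proof.
move=> ufin; have ufn : opnorm q u H2 \is a fin_num.
  by rewrite ge0_fin_numE// opnorm_ge0.
exists (fine (opnorm q u H2) `^ q%:num) => f g Bf Bg.
rewrite -[I]setIT; move: f g Bf Bg; apply/opnorm_restrict_leP => //.
  by rewrite fine_ge0// opnorm_ge0.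
by rewrite fineK// opnorm_whole.
Qed.

Lemma tight_compact_operator : (opnorm q u H2 < +oo)%E ->
  (forall e : R, 0 < e -> \forall c \near decr_to a,
    (opnorm q (restrict_weight u (oitv a c%:E)) H2 <= e%:E)%E) ->
  (forall e : R, 0 < e -> \forall d \near incr_to b,
    (opnorm q (restrict_weight u (oitv d%:E b)) H2 <= e%:E)%E) ->
  compact_operator q u H2.
Proof.
move=> ufin left right; have [M MP] := bounded_pint ufin.
have [x0 /andP[ax0 x0b]] := oitv_nonempty ab.
have [||T [cT TE]] := @cutoff_Hardy2_operator R s a b p1 p2 q p1' p2' v1 v2 u ab
  p1_gt1 p2_gt1 pp1 pp2 v1_pos v2_pos u_loc V1_fin V2_fin setT measurableT.
- by exists M => f g; rewrite setIT; exact: MP.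
(* An operator norm at most [t] near an endpoint means an integral at most [e / 2] there. *)
- move=> e e0; pose t := (e / 2) `^ (q%:num)^-1.
  have e20 : 0 < e / 2 by rewrite divr_gt0.
  have t0 : 0 < t by rewrite powR_gt0.
  have tq : t `^ q%:num = e / 2 by rewrite powRVK ?gt_eqF ?(ltW e20).
  have PFa := decr_to_proper ab; have PFb := incr_to_proper ab.
  have [c [/= cP /andP[ac cx0]]] := filter_ex (filterI (left t t0) (near_decr_to ax0)).
  have [d [/= dP /andP[x0d db]]] := filter_ex (filterI (right t t0) (near_incr_to x0b)).
  have Ic : I c by rewrite /oitv/= ac (lt_trans cx0).
  have Id : I d by rewrite /oitv/= db andbT (lt_trans ax0).
  exists c, d; split => // f g Bf Bg.
  rewrite setTD pint_outside//; last by rewrite -lee_fin ltW// (lt_trans cx0).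
  rewrite [e]splitr EFinD -tq; apply: leeD.
    by move: f g Bf Bg; apply/opnorm_restrict_leP; rewrite ?(ltW t0)//; exact: measurable_oitv.
  by move: f g Bf Bg; apply/opnorm_restrict_leP; rewrite ?(ltW t0)//; exact: measurable_oitv.
exists T; split => // f g.
apply: (@filterS _ _ (ae_filter_ringOfSetsType _) _ _ _ (TE f g)) => x TEx Ix ux.
by rewrite TEx// /cutoff in_setT.
Qed.

(** The compact operator is the cut-off to [c, d], whose tail outside [c, d] is empty; the error is
    H_2 on the two end pieces. *)
Lemma essential_norm_le c d (t1 t2 : R) : (opnorm q u H2 < +oo)%E ->
  I c -> I d -> c <= d -> 0 <= t1 -> 0 <= t2 ->
  (opnorm q (restrict_weight u (oitv a c%:E)) H2 <= t1%:E)%E ->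
  (opnorm q (restrict_weight u (oitv d%:E b)) H2 <= t2%:E)%E ->
  (essential_norm q u H2 <= ((t1 `^ q%:num + t2 `^ q%:num) `^ (q%:num)^-1)%:E)%E.
Proof.
move=> ufin Ic Id cd t10 t20 ct1 dt2; have [M MP] := bounded_pint ufin.
have mcd : measurable `[c, d]%classic by exact: measurable_itv.
have [||T [cT TE]] := @cutoff_Hardy2_operator R s a b p1 p2 q p1' p2' v1 v2 u ab
  p1_gt1 p2_gt1 pp1 pp2 v1_pos v2_pos u_loc V1_fin V2_fin `[c, d]%classic mcd.
- exists M => f g Bf Bg; apply: le_trans (MP f g Bf Bg).
  by apply: subset_pint => //; exact: measurableI.
- move=> e e0; exists c, d; split => // f g _ _.
  by rewrite setDv setI0 pintE integral_set0 lee_fin ltW.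
apply: (@le_trans _ _ (opnorm q u (fun f g x => H2 f g x - Lp_fun (T f g) x)%R)).
  by apply: ereal_inf_lbound; exists T.
apply/opnorm_leP => f g Bf Bg; rewrite wnormE; last 2 first.
- exact: weightP.
- by apply: scalar_measurableB => //; exact: Lp_fun_measurable.
apply/poweR_root_le; rewrite ?powR_ge0 ?pint_ge0//.
rewrite powRVK ?gt_eqF ?addr_ge0 ?powR_ge0//.
rewrite (_ : J I _ = J (I `&` ~` `[c, d]) (H2 f g)).
  rewrite pint_outside// EFinD; apply: leeD.
    by move: f g Bf Bg; apply/opnorm_restrict_leP => //; exact: measurable_oitv.
  by move: f g Bf Bg; apply/opnorm_restrict_leP => //; exact: measurable_oitv.
rewrite -pint_cutoff//; apply: ae_eq_pint => //.
- by apply: scalar_measurableB => //; exact: Lp_fun_measurable.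
- by apply: cutoff_measurable => //; exact: measurableC.
apply: (@filterS _ _ (ae_filter_ringOfSetsType _) _ _ _ (TE f g)) => x TEx Ix ux.
rewrite TEx// /cutoff in_setC; case: (x \in _) => /=.
  by rewrite mulr1n subrr.
by rewrite mulr0n subr0.
Qed.

End Essential_norm.

(** * The compactness criterion and the two-sided bound *)

Local Open Scope ereal_scope.

Theorem corollary7p1 (R : realType) (s : scalars) (a b : \bar R)
    (p1 p2 q : {posnum R}) (p1' p2' : R) (v1 v2 u : weight a b)
    (W : set (R -> \bar R))
    (A : (R -> \bar R) -> (R -> \bar R) -> (R -> \bar R) -> \bar R)
    (C1 C2 : R) :
  let mu := @lebesgue_measure R in
  let H2 := @Hardy2 R s a b p1 p2 v1 v2 in
  let ucut := fun c d : \bar R => restrict_weight u (oitv c d) in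
  let Aminus := fun c : R => A (ucut a c%:E) v1 v2 in
  let Aplus := fun d : R => A (ucut d%:E b) v1 v2 in
  a < b ->
  (1 < p1%:num)%R -> (1 < p2%:num)%R ->
  (p1%:num^-1 + p1'^-1 = 1)%R -> (p2%:num^-1 + p2'^-1 = 1)%R ->
  {ae mu, forall x, oitv a b x -> 0 < v1 x < +oo} ->
  {ae mu, forall x, oitv a b x -> 0 < v2 x < +oo} ->
  locally_integrable_weight a b u ->
  (forall x, oitv a b x ->
    \int[mu]_(t in oitv a x%:E) poweR (v1 t) (1 - p1') < +oo) ->
  (forall x, oitv a b x ->
    \int[mu]_(t in oitv a x%:E) poweR (v2 t) (1 - p2') < +oo) ->
  (forall w, W w -> is_weight a b w) ->
  W u ->
  (forall c d : R, a < c%:E -> (c < d)%R -> d%:E < b ->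
    W (ucut a c%:E) /\ W (ucut d%:E b)) ->
  (0 < C1)%R -> (0 < C2)%R ->
  (forall w, W w -> 0 <= A w v1 v2) ->
  (forall w, W w ->
    C1%:E * A w v1 v2 <= opnorm q w H2 <= C2%:E * A w v1 v2) ->
  (compact_operator q u H2 <->
    [/\ A u v1 v2 < +oo,
        Aminus c @[c --> decr_to a] --> 0 &
        Aplus d @[d --> incr_to b] --> 0]) /\
  (opnorm q u H2 < +oo ->
    let Am := limf_esup Aminus (decr_to a) in
    let Ap := limf_esup Aplus (incr_to b) in
    C1%:E * maxe Am Ap <= essential_norm q u H2 /\
    essential_norm q u H2 <=
      C2%:E * poweR (poweR Am q%:num + poweR Ap q%:num) q%:num^-1).
Proof.
move=> mu H2 ucut Aminus Aplus ab p1_gt1 p2_gt1 pp1 pp2 v1_pos v2_pos u_loc V1_fin V2_fin.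
move=> W_weight Wu W_cut C1_gt0 C2_gt0 A_ge0 A_opnorm.
have PFa := decr_to_proper ab; have PFb := incr_to_proper ab.
have [x0 /andP[ax0 x0b]] := oitv_nonempty ab.
have C1' : 0 < C1%:E by rewrite lte_fin.
have C2' : 0 < C2%:E by rewrite lte_fin.
have nearIa : \forall c \near decr_to a, oitv a b c /\ (c < x0)%R.
  apply: filterS (near_decr_to ax0) => c /andP[ac cx0]; split; last by [].
  by rewrite /oitv/= ac (lt_trans cx0).
have nearIb : \forall d \near incr_to b, oitv a b d /\ (x0 < d)%R.
  apply: filterS (near_incr_to x0b) => d /andP[x0d db]; split; last by [].
  by rewrite /oitv/= db andbT (lt_trans ax0).
(* The class contains the cut-offs for pairs c < d; a partner for the single point is picked between
   it and the other endpoint. *)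
have WIa c : oitv a b c -> W (ucut a c%:E).
  move=> /andP[ac cb]; have [d /andP[cd db]] := filter_ex (near_incr_to cb).
  by case: (W_cut c d ac cd db).
have WIb d : oitv a b d -> W (ucut d%:E b).
  move=> /andP[ad db]; have [c /andP[ac cd]] := filter_ex (near_decr_to ad).
  by case: (W_cut c d ac cd db).
have mo (c d : \bar R) : measurable (oitv c d) by exact: measurable_oitv.
have from_opnorm (w : R -> \bar R) (N : R) : W w -> opnorm q w H2 <= N%:E ->
    0 <= A w v1 v2 <= (N / C1)%:E.
  move=> Ww wN; rewrite A_ge0//= mulrC EFinM lee_pdivlMl//.
  by apply: le_trans wN; case/andP: (A_opnorm _ Ww).
have to_opnorm (w : R -> \bar R) (N : R) : W w -> A w v1 v2 <= N%:E ->
    opnorm q w H2 <= (C2 * N)%:E.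
  move=> Ww wN; case/andP: (A_opnorm _ Ww) => _ /le_trans; apply.
  by rewrite EFinM lee_wpmul2l// ltW.
split.
  split.
    move=> cH2; split.
    - have ufin := compact_operator_bounded p1_gt1 p2_gt1 pp1 pp2 v1_pos v2_pos V1_fin V2_fin cH2.
      have ufn : opnorm q u H2 \is a fin_num by rewrite ge0_fin_numE ?opnorm_ge0.
      have uN : opnorm q u H2 <= (fine (opnorm q u H2))%:E by rewrite fineK.
      by case/andP: (from_opnorm _ _ Wu uN) => _ /le_lt_trans; apply; exact: ltry.
    - apply: cvge0_near => e e0; have N0 : (0 < e * C1)%R by rewrite mulr_gt0.
      have := compact_operator_escaping ab p1_gt1 p2_gt1 pp1 pp2 v1_pos v2_pos V1_fin V2_fin
        (decr_to_filter a) (fun c => mo a c%:E) (@escaping_left R a b) cH2 N0.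
      apply: filterS2 nearIa => c [Ic _] /(from_opnorm _ _ (WIa _ Ic)).
      by rewrite mulfK// gt_eqF.
    - apply: cvge0_near => e e0; have N0 : (0 < e * C1)%R by rewrite mulr_gt0.
      have := compact_operator_escaping ab p1_gt1 p2_gt1 pp1 pp2 v1_pos v2_pos V1_fin V2_fin
        (incr_to_filter b) (fun d => mo d%:E b) (@escaping_right R a b) cH2 N0.
      apply: filterS2 nearIb => d [Id _] /(from_opnorm _ _ (WIb _ Id)).
      by rewrite mulfK// gt_eqF.
  move=> [Au Am0 Ap0].
  apply: (tight_compact_operator ab p1_gt1 p2_gt1 pp1 pp2 v1_pos v2_pos u_loc V1_fin V2_fin).
  - have Afn : A u v1 v2 \is a fin_num by rewrite ge0_fin_numE// A_ge0.
    apply: (@le_lt_trans _ _ (C2 * fine (A u v1 v2))%:E); last exact: ltry.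
    by apply: to_opnorm => //; rewrite fineK.
  - move=> e e0; have e0' : 0 < (e / C2)%:E by rewrite lte_fin divr_gt0.
    have := Am0 _ (open_ereal_lt' e0'); apply: filterS2 nearIa => c [Ic _] /ltW.
    by move=> /(to_opnorm _ _ (WIa _ Ic)); rewrite mulrC divfK// gt_eqF.
  - move=> e e0; have e0' : 0 < (e / C2)%:E by rewrite lte_fin divr_gt0.
    have := Ap0 _ (open_ereal_lt' e0'); apply: filterS2 nearIb => d [Id _] /ltW.
    by move=> /(to_opnorm _ _ (WIb _ Id)); rewrite mulrC divfK// gt_eqF.
move=> ufin Am Ap; split.
  (* The extra [e] provides the strict inequality that [opnorm_escaping] requires for a fixed
     compact [T]; the case of infinite norm of the difference is trivial. *)
  apply/ereal_infP => _ [T cT <-]; apply/lee_addgt0Pr => e e0.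
  have := opnorm_ge0 q u (fun f g x => H2 f g x - Lp_fun (T f g) x)%R.
  move En : (opnorm _ _ _) => n0 n0_ge0.
  have [->|n0y] := eqVneq n0 +oo; first by rewrite addye// leey.
  have n0fin : n0 \is a fin_num by rewrite ge0_fin_numE// lt_neqAle n0y leey.
  have n0N : opnorm q u (fun f g x => H2 f g x - Lp_fun (T f g) x)%R < (fine n0 + e)%:E.
    by rewrite En EFinD fineK// lteDl// lte_fin.
  rewrite -(fineK n0fin) -EFinD -lee_pdivlMl// -EFinM mulrC ge_max; apply/andP; split.
    apply: limf_esup_le_near.
    have := opnorm_escaping ab p1_gt1 p2_gt1 pp1 pp2 v1_pos v2_pos V1_fin V2_fin
      (decr_to_filter a) (fun c => mo a c%:E) (@escaping_left R a b) cT n0N.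
    by apply: filterS2 nearIa => c [Ic _] /(from_opnorm _ _ (WIa _ Ic))/andP[].
  apply: limf_esup_le_near.
  have := opnorm_escaping ab p1_gt1 p2_gt1 pp1 pp2 v1_pos v2_pos V1_fin V2_fin
    (incr_to_filter b) (fun d => mo d%:E b) (@escaping_right R a b) cT n0N.
  by apply: filterS2 nearIb => d [Id _] /(from_opnorm _ _ (WIb _ Id))/andP[].
have q0 : (0 < q%:num)%R by [].
have Am0 : 0 <= Am.
  by apply: limf_esup_ge0_near; apply: filterS nearIa => c [Ic _]; rewrite A_ge0//; exact: WIa.
have Ap0 : 0 <= Ap.
  by apply: limf_esup_ge0_near; apply: filterS nearIb => d [Id _]; rewrite A_ge0//; exact: WIb.
(* If either upper limit is infinite, so is the right-hand side. *)
have yE (z : \bar R) : 0 <= z -> C2%:E * poweR (+oo + z) q%:num^-1 = +oo.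
  move=> z0; rewrite addye ?gt_eqF ?(lt_le_trans _ z0)// poweRyr ?gt_eqF ?invr_gt0//.
  by rewrite gt0_muley.
have [Amy|Amy] := eqVneq Am +oo.
  by rewrite Amy (poweRyr (lt0r_neq0 q0)) yE ?leey// poweR_ge0.
have [Apy|Apy] := eqVneq Ap +oo.
  by rewrite Apy (poweRyr (lt0r_neq0 q0)) addeC yE ?leey// poweR_ge0.
have realE (z : \bar R) : 0 <= z -> z != +oo -> exists2 x : R, (0 <= x)%R & z = x%:E.
  move=> z0 zy; have zfin : z \is a fin_num by rewrite ge0_fin_numE// lt_neqAle zy leey.
  by exists (fine z); rewrite ?fine_ge0 ?fineK.
have [x x_ge0 AmE] := realE _ Am0 Amy; have [y y_ge0 ApE] := realE _ Ap0 Apy.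
rewrite AmE ApE !poweR_EFin -EFinM.
set Z := (x `^ q%:num + y `^ q%:num)%R.
have Z0 : (0 <= Z)%R by rewrite addr_ge0 ?powR_ge0.
apply/lee_addgt0Pr => e e0; rewrite -EFinD.
(* [C2 * N] is the target plus [e]. Half of the gap N^q - Z goes to each end, so that t1^q + t2^q =
   N^q while t1 and t2 strictly exceed the upper limits and hence bound the functional near the
   endpoints. *)
pose N := (Z `^ q%:num^-1 + e / C2)%R.
have NE : (C2 * Z `^ q%:num^-1 + e = C2 * N)%R.
  by rewrite /N; field; rewrite gt_eqF.
have eC2 : (0 < e / C2)%R by rewrite divr_gt0.
have N0 : (0 <= N)%R by rewrite addr_ge0 ?powR_ge0 ?ltW.
have ZN : (Z < N `^ q%:num)%R.
  rewrite -[ltLHS](powRVK (lt0r_neq0 q0) Z0).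
  by rewrite gt0_ltr_powR ?nnegrE ?powR_ge0// ltrDl.
pose dl := ((N `^ q%:num - Z) / 2)%R.
have dl0 : (0 < dl)%R by rewrite divr_gt0// subr_gt0.
have root_gt (t : R) : (0 <= t)%R -> (t < (t `^ q%:num + dl) `^ q%:num^-1)%R.
  move=> t0; rewrite -[ltLHS](powRKV (lt0r_neq0 q0) t0).
  by rewrite gt0_ltr_powR ?invr_gt0 ?nnegrE ?addr_ge0 ?powR_ge0 ?(ltW dl0)// ltrDl.
pose t1 := ((x `^ q%:num + dl) `^ q%:num^-1)%R.
pose t2 := ((y `^ q%:num + dl) `^ q%:num^-1)%R.
have t1E : (t1 `^ q%:num = x `^ q%:num + dl)%R.
  by rewrite powRVK ?gt_eqF// addr_ge0 ?powR_ge0 ?ltW.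
have t2E : (t2 `^ q%:num = y `^ q%:num + dl)%R.
  by rewrite powRVK ?gt_eqF// addr_ge0 ?powR_ge0 ?ltW.
have t1p : (0 <= t1)%R by exact: powR_ge0.
have t2p : (0 <= t2)%R by exact: powR_ge0.
have At1 : Am < t1%:E by rewrite AmE lte_fin root_gt.
have At2 : Ap < t2%:E by rewrite ApE lte_fin root_gt.
clearbody t1 t2.
have [c [[Ic cx0] cA]] := filter_ex (filterI nearIa (limf_esup_lt_near _ At1)).
have [d [[Id x0d] dA]] := filter_ex (filterI nearIb (limf_esup_lt_near _ At2)).
have C2p : (0 <= C2)%R by exact: ltW.
have t1_ge0 : (0 <= C2 * t1)%R by exact: mulr_ge0.
have t2_ge0 : (0 <= C2 * t2)%R by exact: mulr_ge0.
have cd : (c <= d)%R by rewrite ltW// (lt_trans cx0).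
apply: le_trans (essential_norm_le ab p1_gt1 p2_gt1 pp1 pp2 v1_pos v2_pos u_loc V1_fin V2_fin
  ufin Ic Id cd t1_ge0 t2_ge0 (to_opnorm _ _ (WIa _ Ic) (ltW cA))
  (to_opnorm _ _ (WIb _ Id) (ltW dA))) _.
rewrite lee_fin NE (powRM _ C2p t1p) (powRM _ C2p t2p) -mulrDr t1E t2E.
have -> : (x `^ q%:num + dl + (y `^ q%:num + dl) = N `^ q%:num)%R.
  by rewrite /dl /Z; field.
by rewrite -(powRM _ C2p N0) powRKV ?gt_eqF ?mulr_ge0.
Qed.
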